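(* The graph isomorphism relation is Borel reducible to the isomorphism relation for countable metrizable groups with the Lévy property. In other words, there is a Borel map $f\colon\mathfrak{R}\to\mathfrak{G}$ such that (i) for any $\alpha\in\mathfrak{R}$, $G_{f(\alpha)}$ has the Lévy property; (ii) for any $\alpha,\beta\in\mathfrak{R}$, we have $\alpha\cong_{\mathfrak{R}}\beta$ if and only if $f(\alpha)\cong_{\mathfrak{G}}f(\beta)$.
   Context: $\mathfrak{R}$ is the set of all binary relations $R\subseteq\mathbb{N}^2$ such that $(\mathbb{N},R)$ is a graph, viewed as a Borel subset of the Polish space $2^{\mathbb{N}^2}$ (hence a standard Borel space). For $\alpha\in\mathfrak{R}$, $\Gamma_\alpha$ is the graph coded by $\alpha$, and $\alpha\cong_{\mathfrak{R}}\beta$ means that $\Gamma_\alpha$ and $\Gamma_\beta$ are isomorphic as graphs. $\mathfrak{G}$ is the standard Borel space of codes for infinite countable metrizable groups: it is the set of all pairs $(R,d)\in 2^{\mathbb{N}^3}\times\mathbb{R}^{\mathbb{N}^2}$ such that $R$ is the graph of the multiplication of a group structure on $\mathbb{N}$ and $d$ is a metric on $\mathbb{N}$ whose topology makes this group a topological group, with the Borel structure inherited from the product topology. For $\gamma\in\mathfrak{G}$, $G_\gamma$ is the topological group coded by $\gamma$, and $\gamma\cong_{\mathfrak{G}}\eta$ means that $G_\gamma$ and $G_\eta$ are isomorphic as topological groups. A topological group $G$ has the Lévy property if there is an increasing sequence $(K_i)_{i\in\mathbb{N}}$ of compact subgroups of $G$, with normalized Haar measures $\mu_i$ on $K_i$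 (regarded as measures on $G$), such that (i) $\bigcup_i K_i$ is dense in $G$, and (ii) for each open neighborhood $V$ of the identity of $G$ and each sequence of Borel sets $A_i\subseteq K_i$ with $\liminf_i\mu_i(A_i)>0$, one has $\lim_i\mu_i(VA_i)=1$. *)

(* Defs.v *)
From HB Require Import structures.
From mathcomp Require Import all_boot all_order all_algebra.
From mathcomp Require Import all_classical all_reals all_analysis.

Set Implicit Arguments.
Unset Strict Implicit.
Unset Printing Implicit Defensive.

Import Order.TTheory GRing.Theory Num.Theory.
Import numFieldTopology.Exports.

Local Open Scope classical_set_scope.
Local Open Scope ring_scope.

Definition borel_fun (X Y : topologicalType) (f : X -> Y) : Prop :=
  forall B : set Y, <<s (@open Y) >> B -> <<s (@open X) >> (f @^-1` B).

HB.mixin Record isTopologicalGroup G & Group G & Topological G := {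
  mulg_continuous : continuous (fun p : G * G => (p.1 * p.2)%g) ;
  invg_continuous : continuous (fun x : G => (x^-1)%g)
}.

(* The point is irrelevant mathematically: the library only turns a generated *)
(* sigma-algebra into a measurableType over a pointedType.                    *)
#[short(type="topologicalGroupType")]
HB.structure Definition TopologicalGroup :=
  {G of Group G & Pointed G & Topological G & isTopologicalGroup G}.

Definition topgroup_iso (G H : topologicalGroupType) : Prop :=
  exists (phi : G -> H) (psi : H -> G),
    [/\ cancel phi psi, cancel psi phi,
        {morph phi : x y / (x * y)%g >-> (x * y)%g},
        continuous phi & continuous psi].

Notation borel G := (g_sigma_algebraType (@open G)).

(* The normalized Haar measure of the compact subgroup K, regarded as a       *)
(* probability measure on the Borel sets of G that is concentrated on K. In a *)
(* Hausdorff group the condition "closed C" follows from "compact C".         *)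
Definition normalized_haar (R : realType) (G : topologicalGroupType)
    (K : set G) (mu : probability (borel G) R) : Prop :=
  [/\ mu K = 1%E,
      forall (x : G) (A : set (borel G)), K x -> measurable A ->
        mu [set (x * a)%g | a in A] = mu A &
      forall A : set (borel G), measurable A ->
        mu A = ereal_sup
          [set mu C | C in [set C : set G |
                             [/\ compact C, closed C & C `<=` A]]]].

Definition levy_property (R : realType) (G : topologicalGroupType) : Prop :=
  exists (K : nat -> set G) (mu : nat -> probability (borel G) R),
    [/\ forall i, compact (K i) /\ group_closed [in K i],
        forall i j, (i <= j)%N -> K i `<=` K j,
        forall i, normalized_haar (K i) (mu i),
        dense (\bigcup_i K i) &
        forall (V : set G) (A : nat -> set (borel G)),
          open V -> V 1%g ->
          (forall i, measurable (A i) /\ A i `<=` K i) ->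
          (0 < limn_einf (fun i => mu i (A i)))%E ->
          mu i [set (v * a)%g | v in V & a in A i] @[i --> \oo] --> 1%E].

Definition graph_codes : set {ptws (nat * nat) -> bool} :=
  [set a | symmetric (fun x y => a (x, y)) /\
           irreflexive (fun x y => a (x, y))].

Definition graph_code : topologicalType := set_type graph_codes.

Definition edge (a : graph_code) : rel nat := fun x y => set_val a (x, y).

Definition graph_iso (a b : graph_code) : Prop :=
  exists2 phi : nat -> nat,
    bijective phi & forall x y, edge a x y = edge b (phi x) (phi y).

Definition is_metric (R : realType) (d : nat * nat -> R) : Prop :=
  [/\ forall x, d (x, x) = 0,
      forall x y, d (x, y) = 0 -> x = y,
      forall x y, d (x, y) = d (y, x) &
      forall y x z, d (x, z) <= d (x, y) + d (y, z)].

Definition metric_nat (R : realType) (d : nat * nat -> R) (hd : is_metric d)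
  : Type := nat.

Section metric_nat.
Context (R : realType) (d : nat * nat -> R) (hd : is_metric d).

HB.instance Definition _ := Pointed.copy (metric_nat hd) nat.

Let dist (x y : metric_nat hd) : R := d (x, y).

Let distxx x : dist x x = 0. Proof. have [h _ _ _] := hd; exact: h. Qed.

Let dist_positivity x y : dist x y = 0 -> x = y.
Proof. have [_ h _ _] := hd; exact: h. Qed.

Let dist_sym x y : dist x y = dist y x.
Proof. have [_ _ h _] := hd; exact: h. Qed.

Let dist_triangle y x z : dist x z <= dist x y + dist y z.
Proof. have [_ _ _ h] := hd; exact: h. Qed.

HB.instance Definition _ := isMetric.Build R (metric_nat hd)
  distxx dist_positivity dist_sym dist_triangle.

End metric_nat.

Definition group_code_space (R : realType) : topologicalType :=
  ({ptws (nat * nat * nat) -> bool} * {ptws (nat * nat) -> R})%type.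

(* What it means for c = (graph of multiplication, metric) to code a          *)
(* topological group with underlying set nat.                                 *)
Record coded_group (R : realType) (c : group_code_space R) := CodedGroup {
  cg_metric : is_metric c.2 ;
  cg_mul : nat -> nat -> nat ;
  cg_one : nat ;
  cg_inv : nat -> nat ;
  cg_mulA : associative cg_mul ;
  cg_mul1 : left_id cg_one cg_mul ;
  cg_mulr1 : right_id cg_one cg_mul ;
  cg_mulV : left_inverse cg_one cg_inv cg_mul ;
  cg_mulrV : right_inverse cg_one cg_inv cg_mul ;
  cg_graph : forall x y z, c.1 (x, y, z) = (cg_mul x y == z) ;
  cg_mul_continuous :
    continuous ((fun p => cg_mul p.1 p.2) :
      metric_nat cg_metric * metric_nat cg_metric -> metric_nat cg_metric) ;
  cg_inv_continuous :
    continuous (cg_inv : metric_nat cg_metric -> metric_nat cg_metric)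
}.

Definition group_codes (R : realType) : set (group_code_space R) :=
  [set c | inhabited (coded_group c)].

Definition group_code (R : realType) : topologicalType :=
  set_type (@group_codes R).

(* The fields of coded_group are determined by c, so that the choice made     *)
(* here is immaterial.                                                        *)
Definition coded_group_of (R : realType) (c : group_code R) :
    coded_group (set_val c) :=
  sval (cid (let: inhabits s := set_valP c in ex_intro (fun=> True) s I)).

Definition code_group (R : realType) (c : group_code R) : Type :=
  metric_nat (cg_metric (coded_group_of c)).

Section code_group.
Context (R : realType) (c : group_code R).
Let s := coded_group_of c.

HB.instance Definition _ := Metric.on (code_group c).
HB.instance Definition _ := Pointed.on (code_group c).
HB.instance Definition _ := isGroup.Build (code_group c)
  (cg_mulA s) (cg_mul1 s) (cg_mulr1 s) (cg_mulV s) (cg_mulrV s).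
HB.instance Definition _ := isTopologicalGroup.Build (code_group c)
  (@cg_mul_continuous _ _ s) (@cg_inv_continuous _ _ s).

End code_group.

(* Main.v *)
From HB Require Import structures.
Require Import Defs.
From mathcomp Require Import all_boot all_order all_algebra.
From mathcomp Require Import all_classical all_reals all_analysis.
From mathcomp Require Import ring lra.

(** A graph is turned into a group in two moves: a locally finite group [H]
    that remembers the graph, then the group [S(H)] of locally constant
    functions from the Cantor space to [H], with the metric
    [d(g, h) = mu {x | g x <> h x}] for the fair coin-tossing measure [mu].

    The Levy property. The metric is invariant under translations. Let [H_n]
    be the [n]-th member of an increasing sequence of finite subgroups with
    union [H]. The functions with values in [H_n] that read only [n]
    coordinates form a finite group [K_n], and these groups exhaust [S(H)].
    As a metric space [K_n] is the power [H_n^(2^n)] with its normalized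
    Hamming distance, whose concentration of measure is elementary: a
    1-Lipschitz function on it has variance at most a multiple of [2^-n],
    because a power of exponent [2^(n+1)] is a square of one of exponent
    [2^n] and the variance is subadditive over the two factors
    ([variance_tensor], [tree_variance]). Chebyshev's inequality for the
    distance to a set of measure bounded below ([tree_concentration]) then
    gives the Levy property ([coded_by_rel_levy]).

    Coding. For a symmetric irreflexive relation [r] on the vertices, [H]
    is the semidirect product of the sign group [B], the direct sum of copies of
    [F_2] indexed by the vertices, acting on a copy of [F_3] for each vertex
    and a copy of [F_5] for each pair of vertices. The generator [i] of [B]
    negates the [F_3] of [i] and the [F_5] of each [(i, j)] or [(j, i)] with
    [r i j]. A point of the Cantor space and a vertex form a site; an element
    of order 3 of [S(H)] has a set of sites as its support.

    Reconstruction uses only the abstract group. Two elements of order 3 have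
    disjoint supports iff some element inverts the one and centralizes the
    other ([separatedP]); if so, their supports contain two [r]-adjacent
    vertices over the same point iff some nontrivial element of order 5
    follows their sign behaviour ([linkedP]). A group isomorphism therefore
    transports supports and, by bisection of the Cantor space, single sites
    ([corresponds_exists]), in such a way that adjacent vertices over one
    point go to adjacent vertices over one point ([corresponds_adjacent]).
    If [r] is connected, the vertices over a point go to the vertices over a
    point, so the isomorphism class of [r] is recovered. Connectedness is
    enforced by taking for [r] the cone over the given graph, which determines
    the graph ([cone_descend]).

    Neither the underlying set of [S(H)] nor the metric depends on the graph,
    so one enumeration of the set by [nat] serves all graphs. A product of two
    given elements depends on finitely many edges only; hence the coding map
    is continuous, and a fortiori Borel. *)

Set Implicit Arguments.
Unset Strict Implicit.
Unset Printing Implicit Defensive.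

Import Order.TTheory GRing.Theory Num.Theory.
Import numFieldTopology.Exports.

Local Open Scope classical_set_scope.
Local Open Scope ring_scope.

(** * Coin-tossing measure and concentration of measure on finite powers *)

Definition cantor := nat -> bool.

Definition scons (b : bool) (x : cantor) : cantor :=
  fun i => if i is j.+1 then x j else b.

(** Local constancy, in a uniform form: [g] reads only the first [n] bits. By
    compactness of the Cantor space every locally constant function does so
    for some [n]. *)
Definition depends T (n : nat) (g : cantor -> T) : Prop :=
  forall x y, (forall i, (i < n)%N -> x i = y i) -> g x = g y.

Lemma depends_scons T n (g : cantor -> T) b :
  depends n.+1 g -> depends n (fun x => g (scons b x)).
Proof. by move=> gn x y xy; apply: gn => -[|i] //= /xy. Qed.

Lemma depends_leq T n m (g : cantor -> T) :
  (n <= m)%N -> depends n g -> depends m g.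
Proof.
by move=> nm gn x y xy; apply: gn => i /leq_trans-/(_ _ nm); apply: xy.
Qed.

Definition differ T (g h : cantor -> T) : cantor -> bool :=
  fun x => `[< g x <> h x >].

Lemma depends_differ T n (g h : cantor -> T) :
  depends n g -> depends n h -> depends n (differ g h).
Proof. by move=> gn hn x y xy; rewrite /differ (gn x y)// (hn x y). Qed.

Section density.
Context {R : realType}.
Implicit Types D : cantor -> bool.

(** The coin-tossing measure of a clopen set that reads only [n] bits, computed
    by conditioning on the first bit. *)
Fixpoint avg n D : R :=
  if n is m.+1 then
    (avg m (fun x => D (scons false x)) + avg m (fun x => D (scons true x))) / 2
  else (D (fun=> false))%:R.

Lemma avg_ge0 n D : 0 <= avg n D.
Proof.
elim: n D => [|n IH] D /=; first exact: ler0n.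
by rewrite divr_ge0// addr_ge0.
Qed.

Lemma avg_depends n m D : depends n D -> avg (n + m) D = avg n D.
Proof.
elim: n D => [|n IH] D Dn; last by rewrite /= !IH //; exact: depends_scons.
rewrite add0n; elim: m D Dn => [//|m IH] D Dn /=.
have E b : avg m (fun x => D (scons b x)) = (D (fun=> false))%:R.
  by rewrite IH => [|x y _]; [rewrite /= (Dn _ (fun=> false))|exact: Dn].
by rewrite !E; field.
Qed.

Lemma avg_subadditive n D D1 D2 :
  (forall x, D x -> D1 x || D2 x) -> avg n D <= avg n D1 + avg n D2.
Proof.
elim: n D D1 D2 => [|n IH] D D1 D2 H /=.
  rewrite -natrD ler_nat; have := H (fun=> false).
  by case: (D _) => //; case: (D1 _) => //; case: (D2 _) => // /(_ isT).
have h b := IH _ (fun x => D1 (scons b x)) (fun x => D2 (scons b x)) (fun x => H (scons b x)).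
have := h false; have := h true; rewrite /=; lra.
Qed.

Lemma avg_false n : avg n (fun=> false) = 0.
Proof. by elim: n => //= n ->; rewrite addr0 mul0r. Qed.

Lemma avg_eq0 n D : depends n D -> avg n D = 0 -> forall x, D x = false.
Proof.
elim: n D => [|n IH] D Dn /=.
  by move=> /eqP; rewrite pnatr_eq0 eqb0 => /negbTE D0 x; rewrite -D0; exact: Dn.
have := avg_ge0 n (fun x => D (scons false x)).
have := avg_ge0 n (fun x => D (scons true x)) => h1 h0 h x.
have -> : D x = D (scons (x 0%N) (fun i => x i.+1)) by apply: Dn => -[].
have IHb b : avg n (fun x => D (scons b x)) = 0 -> D (scons b (fun i => x i.+1)) = false.
  by move=> Db; exact: (IH _ (depends_scons b Dn) Db).
by case: (x 0%N); apply: IHb; lra.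
Qed.

(** The number of bits read is chosen arbitrarily; [densityE] shows that it
    does not matter. *)
Definition density D : R := avg (xget 0%N [set n | depends n D]) D.

Lemma densityE n D : depends n D -> density D = avg n D.
Proof.
move=> Dn; rewrite /density; case: xgetP => [m _ /= Dm|/(_ n)//].
have [/subnKC <-|/ltnW/subnKC <-] := leqP m n; first by rewrite avg_depends.
by rewrite avg_depends.
Qed.

End density.

(** A function on the Cantor space that reads [n] bits and takes its values in
    [P] is stored as a complete binary tree of depth [n]. Compared with a
    function on bit strings, the tree makes the step from [n] to [n + 1] a
    binary product, which is what the variance estimate needs. *)
Fixpoint tree (P : finType) (n : nat) : finType :=
  if n is m.+1 then (tree P m * tree P m)%type else P.

Section concentration.
Context {R : realType} (P : finType) (U : Type) (iota : P -> U).

Fixpoint leaf n : tree P n -> cantor -> U :=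
  match n return tree P n -> cantor -> U with
  | 0 => fun p _ => iota p
  | m.+1 => fun s x => leaf (if x 0%N then s.2 else s.1) (fun i => x i.+1)
  end.

Definition tree_dist n (s t : tree P n) : R := avg n (differ (leaf s) (leaf t)).

Lemma tree_distE n (s t : tree P n.+1) :
  tree_dist s t = (tree_dist s.1 t.1 + tree_dist s.2 t.2) / 2.
Proof. by []. Qed.

Lemma tree_dist_triangle n (t s u : tree P n) :
  tree_dist s u <= tree_dist s t + tree_dist t u.
Proof.
apply: avg_subadditive => x /asboolP su; apply/orP.
by have [st|] := pselect (leaf s x = leaf t x);
  [right|left]; apply/asboolP => //; rewrite -st.
Qed.

Lemma tree_dist0 n (s : tree P n) : tree_dist s s = 0.
Proof.
rewrite /tree_dist (_ : differ _ _ = fun=> false) ?avg_false//.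
by apply/funext => x; apply/asboolP; apply.
Qed.

Lemma tree_distC n (s t : tree P n) : tree_dist s t = tree_dist t s.
Proof.
rewrite /tree_dist (_ : differ _ _ = differ (leaf t) (leaf s))//.
by apply/funext => x; apply/asbool_equiv_eq; split => /nesym.
Qed.

Lemma tree_dist_le1 (s t : tree P 0) : tree_dist s t <= 1.
Proof. by rewrite /tree_dist /= lern1 leq_b1. Qed.

Let V (I : finType) (f : I -> R) := \sum_(s : I) \sum_(t : I) (f s - f t) ^+ 2.

Lemma quadrilateral (p q r s : R) :
  (p - s) ^+ 2 + (q - r) ^+ 2 <=
  (p - q) ^+ 2 + (r - s) ^+ 2 + ((p - r) ^+ 2 + (q - s) ^+ 2).
Proof. have := sqr_ge0 (p + s - q - r); lra. Qed.

(** Subadditivity of the variance over a product, for [V f] proportional to the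
    variance of [f]. Summed over all quadruples [(i, j, i', j')], the two
    diagonals of the rectangle contribute [V f] each, and opposite sides
    contribute the same, so the quadrilateral inequality is all that is
    needed. *)
Lemma variance_tensor (I J : finType) (f : I * J -> R) :
  V f <= #|J|%:R * \sum_j V (fun i => f (i, j)) +
         #|I|%:R * \sum_i V (fun j => f (i, j)).
Proof.
pose S4 (F : I -> J -> I -> J -> R) := \sum_i \sum_j \sum_i' \sum_j' F i j i' j'.
have S4D F G : S4 (fun i j i' j' => F i j i' j' + G i j i' j') = S4 F + S4 G.
  rewrite /S4 -big_split; apply: eq_bigr => i _ /=.
  rewrite -big_split; apply: eq_bigr => j _ /=.
  rewrite -big_split; apply: eq_bigr => i' _ /=.
  by rewrite -big_split.
have VE : V f = S4 (fun i j i' j' => (f (i, j) - f (i', j')) ^+ 2).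
  rewrite /V /S4 [RHS]pair_bigA /=; apply: eq_bigr => -[i j] _ /=.
  by rewrite [RHS]pair_bigA /=; apply: eq_bigr => -[].
have swap1 F : S4 F = S4 (fun i j i' j' => F i' j i j').
  rewrite /S4 [LHS]exchange_big [RHS]exchange_big /=.
  by apply: eq_bigr => j _; exact: exchange_big.
have swap2 F : S4 F = S4 (fun i j i' j' => F i j' i' j).
  rewrite /S4; apply: eq_bigr => i _; rewrite [LHS]exchange_big [RHS]exchange_big /=.
  by apply: eq_bigr => i' _; exact: exchange_big.
have VE' : V f = S4 (fun i j i' j' => (f (i', j) - f (i, j')) ^+ 2).
  by rewrite VE swap1.
have I1 : S4 (fun i j i' j' => (f (i, j) - f (i', j)) ^+ 2) =
    #|J|%:R * \sum_j V (fun i => f (i, j)).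
  rewrite /S4 exchange_big mulr_sumr; apply: eq_bigr => j _ /=.
  rewrite /V mulr_sumr; apply: eq_bigr => i _.
  rewrite mulr_sumr; apply: eq_bigr => i' _.
  by rewrite sumr_const mulr_natl.
have I2 : S4 (fun i j i' j' => (f (i, j') - f (i', j')) ^+ 2) =
    #|J|%:R * \sum_j V (fun i => f (i, j)).
  by rewrite -I1 swap2.
have I3 : S4 (fun i j i' j' => (f (i, j) - f (i, j')) ^+ 2) =
    #|I|%:R * \sum_i V (fun j => f (i, j)).
  rewrite /S4 mulr_sumr; apply: eq_bigr => i _ /=.
  rewrite /V mulr_sumr; apply: eq_bigr => j _.
  rewrite sumr_const mulr_natl //.
have I4 : S4 (fun i j i' j' => (f (i', j) - f (i', j')) ^+ 2) =
    #|I|%:R * \sum_i V (fun j => f (i, j)).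
  by rewrite -I3 swap1.
suff : V f + V f <= (#|J|%:R * \sum_j V (fun i => f (i, j)) +
          #|J|%:R * \sum_j V (fun i => f (i, j))) +
         (#|I|%:R * \sum_i V (fun j => f (i, j)) +
         #|I|%:R * \sum_i V (fun j => f (i, j))) by lra.
rewrite {1}VE VE' -{1}I1 -I2 -{1}I3 -I4 -!S4D.
by do 4!(apply: ler_sum => ? _); exact: quadrilateral.
Qed.

(** Passing to depth [n + 1] doubles the number of factors and halves the
    Lipschitz constant along each, so that the bound is multiplied by
    [2 * (1 / 2)^2 = 1 / 2]. *)
Lemma tree_variance n (f : tree P n -> R) (L : R) :
  (forall s t, `|f s - f t| <= L * tree_dist s t) ->
  V f <= L ^+ 2 / 2 ^+ n * #|tree P n|%:R ^+ 2.
Proof.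
have cst (I : finType) (c : R) : \sum_(i : I) c = #|I|%:R * c.
  by rewrite sumr_const mulr_natl.
elim: n f L => [|n IH] f L fL.
  rewrite expr0 divr1 [_%:R ^+ 2]expr2 [leRHS]mulrC -mulrA -!cst.
  apply: ler_sum => s _; apply: ler_sum => t _.
  rewrite -(real_normK (num_real (f s - f t))) -(real_normK (num_real L)).
  rewrite lerXn2r ?nnegrE//.
  apply: le_trans (fL s t) _; rewrite (le_trans (ler_norm _))// normrM.
  rewrite [`|tree_dist _ _|]ger0_norm ?avg_ge0 //.
  by apply: ler_piMr => //; exact: tree_dist_le1.
apply: le_trans (variance_tensor _) _; rewrite card_prod natrM.
set N := #|_|%:R.
pose K := (L / 2) ^+ 2 / 2 ^+ n * N ^+ 2 : R.
have h1 : \sum_j V (fun i => f (i, j)) <= N * K.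
  rewrite -cst; apply: ler_sum => j _; apply: IH => s t.
  by apply: le_trans (fL _ _) _; rewrite tree_distE tree_dist0; lra.
have h2 : \sum_j V (fun i => f (j, i)) <= N * K.
  rewrite -cst; apply: ler_sum => j _; apply: IH => s t.
  by apply: le_trans (fL _ _) _; rewrite tree_distE tree_dist0; lra.
have N0 : 0 <= N by exact: ler0n.
apply: le_trans (lerD (ler_wpM2l N0 h1) (ler_wpM2l N0 h2)) _.
rewrite le_eqVlt; apply/orP; left; apply/eqP.
by rewrite /K [2 ^+ n.+1]exprS; field; rewrite expf_neq0.
Qed.

(** Chebyshev's inequality: the distance to [A], truncated at [e], vanishes on
    [A] and equals [e] on [B], so each pair in [A * B] contributes [e^2] to
    the double sum that the variance bound controls. *)
Lemma tree_concentration n (A B : {pred tree P n}) (e : R) : 0 < e ->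
  (forall s t, s \in A -> t \in B -> e <= tree_dist s t) ->
  e ^+ 2 * #|A|%:R * #|B|%:R <= #|tree P n|%:R ^+ 2 / 2 ^+ n.
Proof.
move=> e0 AB.
(* The default value [e] of the minimum truncates the distance. *)
pose f t : R := \big[Num.min/e]_(s in A) tree_dist s t.
have fA s : s \in A -> f s = 0.
  move=> sA; apply/le_anti; apply/andP; split.
    by rewrite -(tree_dist0 s); apply: bigmin_le_cond.
  by apply: le_bigmin => [|t _]; [exact: ltW|exact: avg_ge0].
have fB t : t \in B -> f t = e.
  move=> tB; apply/le_anti; rewrite bigmin_le_id /=.
  by apply: le_bigmin => // s sA; exact: AB.
have lip1 s t : f s <= f t + 1 * tree_dist s t.
  rewrite -lerBlDr mul1r; apply: le_bigmin => [|u uA].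
    by rewrite lerBlDr (le_trans (bigmin_le_id _ _ _ _))// lerDl avg_ge0.
  rewrite lerBlDr (le_trans (bigmin_le_cond _ _ uA))//.
  by rewrite (tree_distC s) tree_dist_triangle.
have lip s t : `|f s - f t| <= 1 * tree_dist s t.
  have := lip1 s t; have := lip1 t s; rewrite (tree_distC t s) ler_norml; lra.
have := tree_variance lip; rewrite expr1n mul1r mulrC; apply: le_trans.
have -> : e ^+ 2 * #|A|%:R * #|B|%:R = \sum_(s in A) \sum_(t in B) (f s - f t) ^+ 2.
  rewrite (eq_bigr (fun=> #|B|%:R * e ^+ 2)).
    by rewrite sumr_const -[RHS]mulr_natl; ring.
  move=> s sA; rewrite (eq_bigr (fun=> e ^+ 2)) ?sumr_const ?mulr_natl//.
  by move=> t tB; rewrite fA// fB// sub0r sqrrN.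
rewrite /V big_mkcond; apply: ler_sum => s _.
case: ifP => _; last by apply: sumr_ge0 => t _; exact: sqr_ge0.
by rewrite big_mkcond; apply: ler_sum => t _; case: ifP => // _; exact: sqr_ge0.
Qed.

End concentration.

(** * The group of locally constant functions and its elements of order 3 and 5 *)

(** The values of the functions. The carrier of [H] is cut out later by
    requiring finite support ([supported]); here infinite supports are
    harmless and spare a subtype. *)
Record fiber := Fiber {
  bpart : nat -> bool ; apart : nat -> 'F_3 ; cpart : nat -> nat -> 'F_5 }.

Lemma fiber_ext u v : bpart u =1 bpart v -> apart u =1 apart v ->
  (forall i j, cpart u i j = cpart v i j) -> u = v.
Proof.
case: u v => [b a c] [b' a' c'] /= /funext-> /funext-> cc; congr Fiber.
by apply/funext => i; apply/funext => j.
Qed.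

Definition sgn (V : zmodType) (b : bool) (x : V) := if b then - x else x.

Section fiber_group.
Variable r : rel nat.

(** The sign by which [u] acts on the copy of [F_5] of the pair [(i, j)]. It is
    trivial on pairs that are not related, so the set underlying the group
    does not depend on [r]. *)
Definition chi u i j := r i j && (bpart u i (+) bpart u j).

Definition fmul u v := Fiber (fun i => bpart u i (+) bpart v i)
  (fun i => apart u i + sgn (bpart u i) (apart v i))
  (fun i j => cpart u i j + sgn (chi u i j) (cpart v i j)).

Definition fone := Fiber (fun=> false) (fun=> 0) (fun _ _ => 0).

Definition finv u := Fiber (bpart u)
  (fun i => - sgn (bpart u i) (apart u i))
  (fun i j => - sgn (chi u i j) (cpart u i j)).

Lemma chiM u v i j : chi (fmul u v) i j = chi u i j (+) chi v i j.
Proof. by rewrite /chi /=; case: r => //=; rewrite addbACA. Qed.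

Lemma fmulA : associative fmul.
Proof.
move=> u v w; apply: fiber_ext => [i|i|i j]; rewrite ?chiM /=.
- by rewrite addbA.
- by rewrite /sgn; case: (bpart u i); case: (bpart v i); rewrite /= ?opprD ?opprK addrA.
- by rewrite chiM /sgn; case: (chi u i j); case: (chi v i j);
    rewrite /= ?opprD ?opprK addrA.
Qed.

Lemma fmul1 : left_id fone fmul.
Proof.
move=> u; apply: fiber_ext => [i|i|i j] //=; rewrite /sgn /= ?add0r//.
by rewrite /chi /= andbF.
Qed.

Lemma fmulr1 : right_id fone fmul.
Proof.
move=> u; apply: fiber_ext => [i|i|i j] //=; rewrite /sgn ?addbF ?oppr0 ?if_same ?addr0//.
Qed.

Lemma fmulV : left_inverse fone finv fmul.
Proof.
move=> u; apply: fiber_ext => [i|i|i j] //=; rewrite /sgn ?addbb//=.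
- by rewrite addNr.
- by rewrite /chi /= addNr.
Qed.

Lemma fmulrV : right_inverse fone finv fmul.
Proof.
move=> u; apply: fiber_ext => [i|i|i j] //=; rewrite /sgn ?addbb//=.
- by case: (bpart u i); rewrite ?opprK subrr.
- by case: (chi u i j); rewrite ?opprK subrr.
Qed.

Definition gmul (g h : cantor -> fiber) : cantor -> fiber :=
  fun x => fmul (g x) (h x).
Definition gone : cantor -> fiber := fun=> fone.
Definition ginv (g : cantor -> fiber) : cantor -> fiber := fun x => finv (g x).

Lemma gmulA : associative gmul.
Proof. by move=> f g h; apply/funext => x; exact: fmulA. Qed.

Lemma gmul1 : left_id gone gmul.
Proof. by move=> g; apply/funext => x; exact: fmul1. Qed.

Lemma gmulr1 : right_id gone gmul.
Proof. by move=> g; apply/funext => x; exact: fmulr1. Qed.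

Lemma gmulV : left_inverse gone ginv gmul.
Proof. by move=> g; apply/funext => x; exact: fmulV. Qed.

Lemma gmulrV : right_inverse gone ginv gmul.
Proof. by move=> g; apply/funext => x; exact: fmulrV. Qed.

End fiber_group.

Definition supported n u := forall i, (n <= i)%N ->
  [/\ bpart u i = false, apart u i = 0 &
      forall j, cpart u i j = 0 /\ cpart u j i = 0].

Definition bounded n : set (cantor -> fiber) :=
  [set g | depends n g /\ forall x, supported n (g x)].

(** The set underlying [S(H)]. *)
Definition carrier : set (cantor -> fiber) := [set g | exists n, bounded n g].

Lemma supported_leq n m u : (n <= m)%N -> supported n u -> supported m u.
Proof. by move=> nm nu i /(leq_trans nm); exact: nu. Qed.

Lemma bounded_leq n m : (n <= m)%N -> bounded n `<=` bounded m.
Proof.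
move=> nm g [gn gs]; split; first exact: depends_leq gn.
by move=> x; exact: supported_leq (gs x).
Qed.

Lemma carrier_common g h : carrier g -> carrier h ->
  exists n, bounded n g /\ bounded n h.
Proof.
move=> [n gn] [m hm]; exists (maxn n m); split.
  exact: bounded_leq (leq_maxl _ _) _ gn.
exact: bounded_leq (leq_maxr _ _) _ hm.
Qed.

Lemma boundedM r n g h : bounded n g -> bounded n h -> bounded n (gmul r g h).
Proof.
move=> [gn gs] [hn hs]; split=> [x y xy|x i ni].
  by rewrite /gmul (gn x y)// (hn x y).
have [b a c] := gs x i ni; have [b' a' c'] := hs x i ni.
split; rewrite /= ?b ?b' ?a ?a' /sgn /= ?addr0 // => j.
by rewrite !(c j).1 !(c j).2 !(c' j).1 !(c' j).2 oppr0 !if_same addr0.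
Qed.

Lemma bounded1 n : bounded n gone.
Proof. by split. Qed.

Lemma boundedV r n g : bounded n g -> bounded n (ginv r g).
Proof.
move=> [gn gs]; split=> [x y xy|x i ni].
  by rewrite /ginv (gn x y).
have [b a c] := gs x i ni.
split; rewrite /= ?b ?a /sgn /= ?oppr0 // => j.
by rewrite !(c j).1 !(c j).2 oppr0 !if_same oppr0.
Qed.

Lemma carrierM r g h : carrier g -> carrier h -> carrier (gmul r g h).
Proof.
move=> cg ch; have [n [gn hn]] := carrier_common cg ch.
by exists n; exact: boundedM.
Qed.

Lemma carrier1 : carrier gone.
Proof. by exists 0%N; exact: bounded1. Qed.

Lemma carrierV r g : carrier g -> carrier (ginv r g).
Proof. by move=> [n gn]; exists n; exact: boundedV. Qed.

Definition flips (g : cantor -> fiber) x i := bpart (g x) i.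

(** For elements of order 3 this is the support, as a set of sites: such an
    element has no other nontrivial part. *)
Definition supp (g : cantor -> fiber) x i := apart (g x) i != 0.

Definition finitary (p : cantor -> nat -> bool) := exists n,
  (forall i, depends n (fun x => p x i)) /\ forall x i, p x i -> (i < n)%N.

Lemma supp_finitary g : carrier g -> finitary (supp g).
Proof.
move=> [n [gn gs]]; exists n; split=> [i x y xy|x i].
  by rewrite /supp (gn x y).
by apply: contraNT; rewrite -leqNgt => /(gs x)[_ -> _].
Qed.

(** With [ind3], the test elements of all the arguments below: signs, and
    elements of order 3, with a prescribed support. *)
Definition ind2 (p : cantor -> nat -> bool) : cantor -> fiber :=
  fun x => Fiber (p x) (fun=> 0) (fun _ _ => 0).
Definition ind3 (p : cantor -> nat -> bool) : cantor -> fiber :=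
  fun x => Fiber (fun=> false) (fun i => (p x i)%:R) (fun _ _ => 0).

Lemma carrier_ind2 p : finitary p -> carrier (ind2 p).
Proof.
move=> [n [pn ps]]; exists n; split=> [x y xy|x i ni].
  by congr Fiber; apply/funext => i; exact: pn.
split=> //=; apply/negbTE/negP => /ps; rewrite ltnNge ni //.
Qed.

Lemma carrier_ind3 p : finitary p -> carrier (ind3 p).
Proof.
move=> [n [pn ps]]; exists n; split=> [x y xy|x i ni].
  by congr Fiber; apply/funext => i; congr (nat_of_bool _)%:R; exact: pn.
split=> //=; case E: (p x i) => //.
by move/ps: E; rewrite ltnNge ni.
Qed.

Lemma supp_ind3 p : supp (ind3 p) = p.
Proof. by apply/funext => x; apply/funext => i; rewrite /supp /=; case: (p x i). Qed.

Lemma finitaryI_r p q : finitary p -> (exists n, forall i, depends n (fun x => q x i)) ->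
  finitary (fun x i => p x i && q x i).
Proof.
move=> [n [pn ps]] [m qm]; exists (maxn n m); split=> [i x y xy|x i /andP[/ps]].
  rewrite (pn i x y) ?(qm i x y)// => k km; apply: xy.
    by rewrite (leq_trans km)// leq_maxr.
  by rewrite (leq_trans km)// leq_maxl.
by move=> /leq_trans -> //; exact: leq_maxl.
Qed.

Section recognition.
Variable r : rel nat.
Hypothesis r_sym : symmetric r.
Local Notation gmul := (gmul r).

Definition ord3 g := gmul g (gmul g g) = gone.
Definition ord5 g := gmul g (gmul g (gmul g (gmul g g))) = gone.
Definition cent h f := gmul h f = gmul f h.

(** Equivalent to [h f h^-1 = f^-1]. *)
Definition invt h f := gmul f (gmul h f) = h.

Lemma F5_triple_eq0 (x : 'F_5) : x + (x + x) = 0 -> x = 0.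
Proof. by case: x => -[|[|[|[|[|]]]]] //= lt /(congr1 val) //= _; exact: val_inj. Qed.
Lemma F3_quintuple_eq0 (x : 'F_3) : x + (x + (x + (x + x))) = 0 -> x = 0.
Proof. by case: x => -[|[|[|]]] //= lt /(congr1 val) //= _; exact: val_inj. Qed.
Lemma F3_opp_fixed (x : 'F_3) : - x = x -> x = 0.
Proof. by case: x => -[|[|[|]]] //= lt /(congr1 val) //= _; exact: val_inj. Qed.
Lemma F5_opp_fixed (x : 'F_5) : - x = x -> x = 0.
Proof. by case: x => -[|[|[|[|[|]]]]] //= lt /(congr1 val) //= _; exact: val_inj. Qed.
Lemma F3_triple (x : 'F_3) : x + (x + x) = 0.
Proof. by apply: val_inj; case: x => -[|[|[|]]]. Qed.
Lemma F5_quintuple (x : 'F_5) : x + (x + (x + (x + x))) = 0.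
Proof. by apply: val_inj; case: x => -[|[|[|[|[|]]]]]. Qed.

Lemma ord3P g : ord3 g <->
  forall x, bpart (g x) =1 (fun=> false) /\ forall i j, cpart (g x) i j = 0.
Proof.
split=> [g3 x|g3].
  have {}g3 : fmul r (g x) (fmul r (g x) (g x)) = fone by exact: (congr1 (@^~ x) g3).
  have b0 i : bpart (g x) i = false.
    by have /(congr1 (fun u => bpart u i))/= := g3; case: (bpart _ _).
  split=> // i j; have /(congr1 (fun u => cpart u i j))/= := g3.
  by rewrite /chi !b0 andbF; exact: F5_triple_eq0.
apply/funext => x; have [b0 c0] := g3 x; apply: fiber_ext => [i|i|i j] /=.
- by rewrite b0.
- by rewrite b0 /sgn F3_triple.
- by rewrite /chi !b0 andbF !c0 /sgn !addr0.
Qed.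

Lemma ord5P g : ord5 g <->
  forall x, bpart (g x) =1 (fun=> false) /\ forall i, apart (g x) i = 0.
Proof.
split=> [g5 x|g5].
  have {}g5 : fmul r (g x) (fmul r (g x) (fmul r (g x) (fmul r (g x) (g x)))) = fone.
    by exact: (congr1 (@^~ x) g5).
  have b0 i : bpart (g x) i = false.
    by have /(congr1 (fun u => bpart u i))/= := g5; case: (bpart _ _).
  split=> // i; have /(congr1 (fun u => apart u i))/= := g5.
  by rewrite !b0; exact: F3_quintuple_eq0.
apply/funext => x; have [b0 a0] := g5 x; apply: fiber_ext => [i|i|i j] /=.
- by rewrite b0.
- by rewrite b0 !a0 /sgn !addr0.
- by rewrite /chi !b0 andbF /sgn F5_quintuple.
Qed.

(** An element acts on an element of order 3 site by site, through its sign,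
    and [-x = x] has no nonzero solution in [F_3]. *)
Lemma cent3P h f : ord3 f ->
  cent h f <-> forall x i, supp f x i -> flips h x i = false.
Proof.
move=> /ord3P f3; split=> [hf x i|hf].
  have [b0 _] := f3 x.
  have : fmul r (h x) (f x) = fmul r (f x) (h x) by exact: (congr1 (@^~ x) hf).
  move=> /(congr1 (fun u => apart u i)) /=; rewrite b0 /sgn /flips.
  rewrite addrC => /addIr; case: bpart => // /F3_opp_fixed f0; rewrite /supp f0 eqxx//.
apply/funext => x; have [b0 c0] := f3 x; apply: fiber_ext => [i|i|i j] /=.
- by rewrite addbC.
- rewrite b0 /sgn addrC; congr (_ + _).
  have := hf x i; rewrite /supp /flips.
  by case: eqP => [-> _|_ ->//]; rewrite oppr0 if_same.
- by rewrite c0 /sgn oppr0 if_same addr0 add0r /chi !b0 andbF.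
Qed.

Lemma invt3P h f : ord3 f ->
  invt h f <-> forall x i, supp f x i -> flips h x i.
Proof.
move=> /ord3P f3; split=> [hf x i|hf].
  have [b0 _] := f3 x.
  have : fmul r (f x) (fmul r (h x) (f x)) = h x by exact: (congr1 (@^~ x) hf).
  move=> /(congr1 (fun u => apart u i)) /=; rewrite b0 /sgn /flips.
  case: bpart => //=; rewrite addrC -addrA -[RHS]addr0 => /addrI /eqP.
  by rewrite addr_eq0 => /eqP/esym /F3_opp_fixed f0; rewrite /supp f0 eqxx.
apply/funext => x; have [b0 c0] := f3 x; apply: fiber_ext => [i|i|i j] /=.
- by rewrite b0 addbF.
- rewrite b0 /sgn addrC.
  have := hf x i; rewrite /supp /flips.
  case: eqP => [-> _|_ ->//]; rewrite ?oppr0 ?if_same ?addr0//.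
  by rewrite addrNK.
- by rewrite c0 /sgn oppr0 if_same addr0 add0r /chi !b0 andbF.
Qed.

Lemma cent5P h f : ord5 f ->
  cent h f <-> forall x i j, cpart (f x) i j <> 0 -> chi r (h x) i j = false.
Proof.
move=> /ord5P f3; split=> [hf x i j|hf].
  have [b0 _] := f3 x.
  have : fmul r (h x) (f x) = fmul r (f x) (h x) by exact: (congr1 (@^~ x) hf).
  move=> /(congr1 (fun u => cpart u i j)) /=; rewrite {2}/chi !b0 andbF /sgn.
  by rewrite addrC => /addIr; case: chi => // /F5_opp_fixed f0.
apply/funext => x; have [b0 a0] := f3 x; apply: fiber_ext => [i|i|i j] /=.
- by rewrite addbC.
- by rewrite a0 /sgn oppr0 if_same addr0 add0r !b0.
- rewrite {2}/chi !b0 andbF /sgn addrC; congr (_ + _).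
  have := hf x i j; case: (cpart (f x) i j =P 0) => [->|_ ->//].
  by rewrite oppr0 if_same.
Qed.

Lemma invt5P h f : ord5 f ->
  invt h f <-> forall x i j, cpart (f x) i j <> 0 -> chi r (h x) i j.
Proof.
move=> /ord5P f3; split=> [hf x i j|hf].
  have [b0 _] := f3 x.
  have : fmul r (f x) (fmul r (h x) (f x)) = h x by exact: (congr1 (@^~ x) hf).
  move=> /(congr1 (fun u => cpart u i j)) /=; rewrite {1}/chi !b0 andbF /sgn.
  case: chi => //=; rewrite addrC -addrA -[RHS]addr0 => /addrI /eqP.
  by rewrite addr_eq0 => /eqP/esym /F5_opp_fixed.
apply/funext => x; have [b0 a0] := f3 x; apply: fiber_ext => [i|i|i j] /=.
- by rewrite b0 addbF.
- by rewrite a0 /sgn oppr0 if_same addr0 add0r !b0.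
- rewrite {1}/chi !b0 andbF /sgn addrC.
  have := hf x i j; case: (cpart (f x) i j =P 0) => [->|_ ->//].
    by rewrite oppr0 if_same !addr0.
  by rewrite addrNK.
Qed.

Lemma ord3_ind3 p : ord3 (ind3 p).
Proof. exact/ord3P. Qed.

Definition disjoint_supp f g := forall x i, supp f x i -> ~~ supp g x i.

(** Disjointness of supports, expressed in the language of groups. *)
Definition separated f g := exists2 h, carrier h & invt h f /\ cent h g.

Lemma separatedP f g : carrier f -> ord3 f -> ord3 g ->
  separated f g <-> disjoint_supp f g.
Proof.
move=> cf f3 g3; split=> [[h _ [/(invt3P _ f3) hf /(cent3P _ g3) hg]] x i|fg].
  by move=> /hf hxi; apply/negP => /hg; rewrite hxi.
exists (ind2 (supp f)); first exact/carrier_ind2/supp_finitary.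
split; first exact/invt3P.
by apply/cent3P => // x i; apply: contraTF; exact: fg.
Qed.

(** Adjacency over a common point, expressed in the language of groups: [e]
    stands for pairs made of a vertex in the support of [f] and one in the
    support of [g], and two patterns of signs suffice to force this. *)
Definition linked f g := exists e, [/\ carrier e, ord5 e, e <> gone &
  forall h, carrier h ->
    (cent h f -> cent h g -> cent h e) /\ (invt h f -> cent h g -> invt h e)].

(** Over [x], an element [h] acts on the [F_5] of a related pair [(i, j)] by
    the product of its signs at the sites [(x, i)] and [(x, j)], and on the
    [F_5] of other pairs trivially. Let [(i, j)] be a pair at which [e] is
    nontrivial over [x]. Testing against the [h] that is -1 exactly on the
    support of [f] shows that [r i j] holds and that exactly one of the two
    sites lies in this support. If the other one were outside the support of
    [g], the [h] that is -1 exactly at the sites of its vertex outside both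
    supports would centralize [f] and [g] but not [e]. *)
Lemma linkedP f g : carrier f -> carrier g -> ord3 f -> ord3 g -> disjoint_supp f g ->
  linked f g <-> exists x i j, [/\ r i j, supp f x i & supp g x j].
Proof.
move=> cf cg f3 g3 fg; split=> [[e [ce e5 e1 eh]]|[x [i [j [rij fi gj]]]]].
  have [x [i [j cij]]] : exists x i j, cpart (e x) i j <> 0.
    apply: contra_notP e1 => e0; apply/funext => x.
    have [b0 a0] := (ord5P e).1 e5 x; apply: fiber_ext => // i j /=.
    by apply: contrapT => cij; apply: e0; exists x, i, j.
  have : invt (ind2 (supp f)) e.
    have [_] := eh (ind2 (supp f)) (carrier_ind2 (supp_finitary cf)).
    apply; first exact/invt3P.
    by apply/cent3P => // y k; apply: contraTF; exact: fg.
  move=> /(invt5P _ e5)/(_ x i j cij); rewrite /chi /= => /andP[rij].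
  (* The part of the vertex [k] outside both supports. *)
  pose q k y l := (l == k) && (~~ supp f y l && ~~ supp g y l).
  have cq k : carrier (ind2 (q k)).
    apply/carrier_ind2/finitaryI_r.
      by exists k.+1; split=> // y l /eqP ->.
    have [n [[fn _] [gn _]]] := carrier_common cf cg.
    by exists n => l y z yz; rewrite /supp (fn y z)// (gn y z).
  have hq k : chi r (ind2 (q k) x) i j = false.
    have [h _] := eh _ (cq k); apply: ((cent5P _ e5).1 (h _ _)) => //.
      by apply/cent3P => // y l fl; rewrite /flips /= /q fl andbF.
    by apply/cent3P => // y l gl; rewrite /flips /= /q gl !andbF.
  have E k l : supp f x k -> ~~ supp f x l -> r k l ->
      chi r (ind2 (q l) x) k l = false -> supp g x l.
    move=> fk fl rkl; rewrite /chi rkl /= /q eqxx fl fk andbF /=.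
    by move/negbFE.
  case: (boolP (supp f x i)) => fi; case: (boolP (supp f x j)) => fj //= _.
    by exists x, i, j; split=> //; apply: (E i).
  exists x, j, i; split=> //; first by rewrite r_sym.
  apply: (E j) => //; first by rewrite r_sym.
  by rewrite -(hq i) /chi r_sym addbC.
pose e : cantor -> fiber := fun y => Fiber (fun=> false) (fun=> 0)
  (fun k l => [&& k == i, l == j, supp f y i & supp g y j]%:R).
have e5 : ord5 e by exact/ord5P.
have eP y k l : cpart (e y) k l <> 0 -> [/\ k = i, l = j, supp f y i & supp g y j].
  move=> /=; case: (k =P i) => //= ->; case: (l =P j) => //= ->.
  by case: supp => //; case: supp.
exists e; split=> //.
- have [n [[fn _] [gn _]]] := carrier_common cf cg.
  exists (maxn n (maxn i.+1 j.+1)); split=> [y z yz|y k].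
    rewrite /e; have zy l : (l < n)%N -> y l = z l.
      by move=> ln; apply: yz; rewrite (leq_trans ln)// leq_maxl.
    by rewrite /supp (fn y z zy) (gn y z zy).
  rewrite !geq_max => /and3P[_ ik jk]; split=> // l /=.
  by rewrite (gtn_eqF ik) (gtn_eqF jk) /= andbF.
- move=> /(congr1 (@^~ x))/(congr1 (fun u => cpart u i j)) /=.
  by rewrite !eqxx fi gj.
move=> h ch; split=> [/(cent3P _ f3) hf|/(invt3P _ f3) hf] /(cent3P _ g3) hg.
  by apply/cent5P => // y k l /eP[-> -> /hf + /hg]; rewrite /flips /chi => -> ->; rewrite andbF.
by apply/invt5P => // y k l /eP[-> -> /hf + /hg]; rewrite /flips /chi rij => -> ->.
Qed.

End recognition.

(** * Isomorphisms act on the sites *)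

(** [F] and [G] restrict to inverse isomorphisms between the groups of [r] and
    [r']. *)
Definition giso (r r' : rel nat) (F G : (cantor -> fiber) -> cantor -> fiber) :=
  [/\ forall g, carrier g -> carrier (F g) /\ G (F g) = g,
      forall g, carrier g -> carrier (G g) /\ F (G g) = g &
      forall g h, carrier g -> carrier h -> F (gmul r g h) = gmul r' (F g) (F h)].

Lemma giso_sym r r' F G : giso r r' F G -> giso r' r G F.
Proof.
move=> [FG GF FM]; split=> // g h /GF[cg gE] /GF[ch hE].
by rewrite -{1}gE -{1}hE -FM// (FG _ (carrierM _ cg ch)).2.
Qed.

Section transport.
Variables (r r' : rel nat) (F G : (cantor -> fiber) -> cantor -> fiber).
Hypothesis FG : giso r r' F G.

Lemma giso1 : F gone = gone.
Proof.
have [FK _ FM] := FG; have c1 := carrier1.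
have := FM _ _ c1 c1; rewrite gmul1 => /(congr1 (gmul r' (ginv r' (F gone)))).
by rewrite gmulA gmulV gmul1.
Qed.

Lemma giso_ord3 f : carrier f -> ord3 r f -> ord3 r' (F f).
Proof.
by have [_ _ FM] := FG; move=> cf f3; rewrite /ord3 -!FM ?f3 ?giso1//; exact: carrierM.
Qed.

Lemma giso_ord5 f : carrier f -> ord5 r f -> ord5 r' (F f).
Proof.
have [_ _ FM] := FG; move=> cf f5; rewrite /ord5 -!FM ?f5 ?giso1//;
  by repeat apply: carrierM.
Qed.

Lemma giso_cent h f : carrier h -> carrier f -> cent r h f -> cent r' (F h) (F f).
Proof. by have [_ _ FM] := FG; move=> ch cf hf; rewrite /cent -!FM ?hf. Qed.

Lemma giso_invt h f : carrier h -> carrier f -> invt r h f -> invt r' (F h) (F f).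
Proof.
by have [_ _ FM] := FG; move=> ch cf hf; rewrite /invt -!FM ?hf//; exact: carrierM.
Qed.

Lemma giso_disjoint_supp f g : carrier f -> carrier g -> ord3 r f -> ord3 r g ->
  disjoint_supp f g -> disjoint_supp (F f) (F g).
Proof.
have [FK _ _] := FG => cf cg f3 g3 /(separatedP cf f3 g3)[h ch [hf hg]].
apply/(separatedP (FK _ cf).1 (giso_ord3 cf f3) (giso_ord3 cg g3)).
exists (F h); first exact: (FK _ ch).1.
by split; [exact: giso_invt|exact: giso_cent].
Qed.

End transport.

Lemma giso_linked r r' F G f g : giso r r' F G -> carrier f -> carrier g ->
  linked r f g -> linked r' (F f) (F g).
Proof.
move=> FG cf cg [e [ce e5 e1 eh]]; have GF := giso_sym FG.
have [FK GK _] := FG; exists (F e); split; first exact: (FK _ ce).1.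
- exact: (giso_ord5 FG ce e5).
- move=> Fe; apply: e1; rewrite -(FK _ ce).2 Fe; exact: giso1 GF.
move=> h ch; have [cGh hE] := GK _ ch; have [eh1 eh2] := eh _ cGh.
have c_ f' : carrier f' -> cent r' h (F f') -> cent r (G h) f'.
  move=> cf' /(giso_cent GF ch (FK _ cf').1); by rewrite (FK _ cf').2.
have i_ f' : carrier f' -> invt r' h (F f') -> invt r (G h) f'.
  move=> cf' /(giso_invt GF ch (FK _ cf').1); by rewrite (FK _ cf').2.
split=> hf hg; rewrite -hE.
  by apply: (giso_cent FG) => //; apply: eh1; exact: c_.
by apply: (giso_invt FG) => //; apply: eh2; [exact: i_|exact: c_].
Qed.

Lemma carrier_common_family k (e : nat -> cantor -> fiber) :
  (forall j, (j < k)%N -> carrier (e j)) ->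
  exists n, forall j, (j < k)%N -> bounded n (e j).
Proof.
elim: k => [|k IH] ce; first by exists 0%N.
have [|n en] := IH; first by move=> j jk; apply: ce; exact: leqW.
have [m em] := ce k (leqnn _).
exists (maxn n m) => j; rewrite ltnS leq_eqVlt => /predU1P[->|/en].
  exact: bounded_leq (leq_maxr _ _) _ em.
exact: bounded_leq (leq_maxl _ _) _.
Qed.

(** Inclusion of supports in a finite union is preserved, since it only
    involves disjointness: otherwise an element of order 3 whose support
    contains [(y, i')] but misses the supports of all the [F (e j)] has a
    preimage disjoint from all the [e j], hence from [f], although its own
    support meets that of [F f]. *)
Lemma giso_cover r r' F G f k (e : nat -> cantor -> fiber) y i' :
  giso r r' F G -> carrier f -> ord3 r f ->
  (forall j, (j < k)%N -> carrier (e j) /\ ord3 r (e j)) ->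
  (forall x i, supp f x i -> exists2 j, (j < k)%N & supp (e j) x i) ->
  supp (F f) y i' -> exists2 j, (j < k)%N & supp (F (e j)) y i'.
Proof.
move=> FG cf f3 ec fe Fi; have GF := giso_sym FG; have [FK GK _] := FG.
apply: contrapT => no.
(* The complement of the supports of the [F (e j)] within the vertex [i']. *)
pose p x i := (i == i') && [forall j : 'I_k, ~~ supp (F (e j)) x i].
have cp : carrier (ind3 p).
  apply/carrier_ind3/finitaryI_r.
    by exists i'.+1; split=> // x i /eqP ->.
  have [|n en] := @carrier_common_family k (fun j => F (e j)).
    by move=> j /ec[ce _]; exact: (FK _ ce).1.
  exists n => i x z xz; apply: eq_forallb => j.
  by rewrite /supp ((en j (ltn_ord j)).1 x z).
have [cG pE] := GK _ cp.
have G3 : ord3 r (G (ind3 p)) by apply: (giso_ord3 GF) => //; exact: ord3_ind3.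
have ep j : (j < k)%N -> disjoint_supp (e j) (G (ind3 p)).
  move=> jk; have [ce e3] := ec j jk.
  rewrite -(FK _ ce).2; apply: (giso_disjoint_supp GF) => //.
  - exact: (FK _ ce).1.
  - by apply: (giso_ord3 FG).
  - exact: ord3_ind3.
  move=> x i; rewrite supp_ind3 => ei; rewrite /p negb_and negb_forall.
  by apply/orP; right; apply/existsP; exists (Ordinal jk); rewrite negbK.
have : disjoint_supp f (G (ind3 p)) by move=> x i /fe[j jk]; exact: ep.
move=> /(giso_disjoint_supp FG cf cG f3 G3)/(_ y i' Fi); rewrite pE supp_ind3 /p eqxx /=.
rewrite negb_forall => /existsP[j]; rewrite negbK => ej; apply: no.
by exists j.
Qed.

Definition cylinder (n : nat) (x : cantor) (i : nat) : cantor -> nat -> bool :=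
  fun y k => (k == i) && [forall j : 'I_n, y j == x j].

Lemma carrier_cylinder n x i : carrier (ind3 (cylinder n x i)).
Proof.
apply/carrier_ind3/finitaryI_r; first by exists i.+1; split=> // y k /eqP ->.
by exists n => k y z yz; apply: eq_forallb => j; rewrite yz.
Qed.

Lemma cylinder_center n x i : cylinder n x i x i.
Proof. by rewrite /cylinder eqxx; apply/forallP => j. Qed.

Lemma cylinderP n x i y k :
  reflect (k = i /\ forall j, (j < n)%N -> y j = x j) (cylinder n x i y k).
Proof.
apply: (iffP andP) => [[/eqP -> /forallP h]|[-> h]]; split=> //.
  by move=> j jn; exact/eqP/(h (Ordinal jn)).
by apply/forallP => j; apply/eqP/h.
Qed.

(** The site [(x, i)] is moved to [(y, i')] by the isomorphism. *)
Definition corresponds r (F : (cantor -> fiber) -> cantor -> fiber) x i y i' :=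
  forall f, carrier f -> ord3 r f -> supp f x i = supp (F f) y i'.

Lemma eq_cylinder n x y i : (forall j, (j < n)%N -> x j = y j) -> cylinder n x i = cylinder n y i.
Proof.
move=> xy; apply/funext => z; apply/funext => k; congr andb.
by apply: eq_forallb => j; rewrite xy.
Qed.

Definition set_bit (x : cantor) n b : cantor := fun j => if j == n then b else x j.

(** Some cylinder over the whole Cantor space has an image whose support
    contains the given site, by [giso_cover] applied to a preimage of an
    element supported at the vertex [i']. Halving the cylinder repeatedly,
    again by [giso_cover], yields a point [x] all of whose neighbourhoods have
    this property. Since supports are clopen, it is the required point. *)
Lemma corresponds_exists r r' F G y i' : giso r r' F G -> exists x i, corresponds r F x i y i'.
Proof.
move=> FG; have GF := giso_sym FG; have [FK GK _] := FG.
pose P i n x := supp (F (ind3 (cylinder n x i))) y i'.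
have [i Pi] : exists i, P i 0%N (fun=> false).
  pose f' := ind3 (cylinder 0 (fun=> false) i').
  have [cf fE] := GK f' (carrier_cylinder _ _ _).
  have f3 : ord3 r (G f') by apply: (giso_ord3 GF); [exact: carrier_cylinder|exact: ord3_ind3].
  have [n [_ fn]] := cf.
  have [|||j _ Pj] := @giso_cover _ _ _ _ _ n
    (fun j => ind3 (cylinder 0 (fun=> false) j)) y i' FG cf f3.
  - by move=> j _; split; [exact: carrier_cylinder|exact: ord3_ind3].
  - move=> x i; rewrite /supp => fi; exists i.
      by rewrite ltnNge; apply: contraNN fi => /(fn x)[_ -> _].
    by rewrite -/(supp _ x i) supp_ind3; apply/cylinderP.
  - by rewrite fE supp_ind3; apply/cylinderP.
  by exists j.
have step n x : P i n x -> exists b, P i n.+1 (set_bit x n b).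
  move=> Px; have [|||j _ Pj] := @giso_cover _ _ _ _ _ 2
    (fun j => ind3 (cylinder n.+1 (set_bit x n (j == 0%N)) i)) y i' FG (carrier_cylinder n x i)
    (ord3_ind3 _ _) => //.
  - by move=> j _; split; [exact: carrier_cylinder|exact: ord3_ind3].
  - move=> z k; rewrite supp_ind3 => /cylinderP[-> zx]; exists (~~ z n : nat).
      by case: (z n).
    rewrite supp_ind3; apply/cylinderP; split=> // l; rewrite ltnS leq_eqVlt /set_bit.
    by case: (l =P n) => [-> _|_ /= /zx ->//]; case: (z n).
  by exists (j == 0%N).
(* The bits of [x] are fixed one at a time, keeping [P]. *)
pose nextb n x := set_bit x n (P i n.+1 (set_bit x n true)).
have nextP n x : P i n x -> P i n.+1 (nextb n x).
  move=> /step[b Pb]; rewrite /nextb; case Pt: (P i n.+1 (set_bit x n true)) => //.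
  by case: b Pb => //; rewrite Pt.
pose xs := fix xs n := if n is m.+1 then nextb m (xs m) else (fun=> false : bool).
have xsP n : P i n (xs n) by elim: n => //= n; exact: nextP.
pose x : cantor := fun n => xs n.+1 n.
have xsE n m j : (j < n)%N -> xs (n + m)%N j = xs n j.
  move=> jn; elim: m => [|m IH]; first by rewrite addn0.
  by rewrite addnS /= /nextb /set_bit ltn_eqF ?IH// (leq_trans jn)// leq_addr.
have xE n j : (j < n)%N -> xs n j = x j.
  by move=> jn; rewrite /x -{1}(subnKC jn) xsE.
have {}xsP n : P i n x by have := xsP n; rewrite /P (@eq_cylinder n (xs n) x i)//; exact: xE.
exists x, i => f cf f3; have [n [fn _]] := cf; apply/idP/idP => [fi|].
  have [|||j _ Pj] := @giso_cover _ _ _ _ _ 1 (fun=> f) y i' FG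
    (carrier_cylinder n x i) (ord3_ind3 _ _) => //.
  - by move=> z k; rewrite supp_ind3 => /cylinderP[-> zx]; exists 0%N; rewrite // /supp (fn z x).
  - exact: xsP.
apply: contraTT => fi.
suff : disjoint_supp (ind3 (cylinder n x i)) f.
  move=> /(giso_disjoint_supp FG (carrier_cylinder _ _ _) cf (ord3_ind3 _ _) f3); apply; exact: xsP.
by move=> z k; rewrite supp_ind3 => /cylinderP[-> zx]; rewrite /supp (fn z x).
Qed.

Lemma corresponds_sym r r' F G x i y i' :
  giso r r' F G -> corresponds r F x i y i' -> corresponds r' G y i' x i.
Proof.
move=> FG xy f cf f3; have [FK GK _] := FG; have [cG GE] := GK _ cf.
by rewrite xy ?GE//; by apply: (giso_ord3 (giso_sym FG)).
Qed.

Lemma corresponds_inj r F x i z k y i' :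
  corresponds r F x i y i' -> corresponds r F z k y i' -> x = z /\ i = k.
Proof.
move=> xy zy.
have h n : cylinder n x i z k.
  have c := carrier_cylinder n x i; have o := @ord3_ind3 r (cylinder n x i).
  by have := zy _ c o; rewrite -xy// !supp_ind3 cylinder_center.
split; last by have /cylinderP[] := h 0%N.
by apply/funext => j; have /cylinderP[_ ->] := h j.+1.
Qed.

(** Small disjoint cylinders around the two sites have linked images, since
    the supports of the images contain adjacent sites over a common point; so
    the cylinders themselves are linked, however small they are. *)
Lemma corresponds_adjacent r r' F G x i z k y i' k' : symmetric r -> symmetric r' ->
  irreflexive r' -> giso r r' F G ->
  corresponds r F x i y i' -> corresponds r F z k y k' -> r' i' k' -> x = z /\ r i k.
Proof.
move=> rs rs' ri' FG xy zy ik'; have GF := giso_sym FG; have [FK GK _] := FG.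
have ne : ~ (x = z /\ i = k).
  move=> [xz ik]; subst z k.
  have := corresponds_sym FG xy; have := corresponds_sym FG zy => h h'.
  by have [_ e] := corresponds_inj h h'; rewrite e ri' in ik'.
have key n : ~ (i = k /\ forall j, (j < n)%N -> x j = z j) ->
    r i k /\ forall j, (j < n)%N -> x j = z j.
  move=> nn; pose f := ind3 (cylinder n x i); pose g := ind3 (cylinder n z k).
  have cf : carrier f by exact: carrier_cylinder.
  have cg : carrier g by exact: carrier_cylinder.
  have f3 : ord3 r f by exact: ord3_ind3.
  have g3 : ord3 r g by exact: ord3_ind3.
  have dfg : disjoint_supp f g.
    move=> w l; rewrite !supp_ind3 => /cylinderP[-> wx]; apply/cylinderP => -[ik wz].
    by apply: nn; split=> // j jn; rewrite -wx// wz.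
  have : linked r' (F f) (F g).
    apply/(linkedP rs' (FK _ cf).1 (FK _ cg).1).
    - by apply: (giso_ord3 FG).
    - by apply: (giso_ord3 FG).
    - by apply: (giso_disjoint_supp FG).
    exists y, i', k'; split=> //.
      by rewrite -xy// supp_ind3 cylinder_center.
    by rewrite -zy// supp_ind3 cylinder_center.
  move=> /(giso_linked GF (FK _ cf).1 (FK _ cg).1).
  rewrite (FK _ cf).2 (FK _ cg).2 => /(linkedP rs cf cg f3 g3 dfg).
  move=> [w [a [b [rab]]]]; rewrite !supp_ind3 => /cylinderP[ai wx] /cylinderP[bk wz].
  by subst a b; split=> // j jn; rewrite -wx// wz.
(* Two cylinders of depth [n0] around the two sites are disjoint. *)
have [n0 nn0] : exists n, ~ (i = k /\ forall j, (j < n)%N -> x j = z j).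
  apply: contrapT => h; apply: ne.
  have {}h n : i = k /\ forall j, (j < n)%N -> x j = z j.
    by apply: contrapT => nn; apply: h; exists n.
  split; last exact: (h 0%N).1.
  by apply/funext => j; apply: (h j.+1).2.
split; last exact: (key _ nn0).1.
apply/funext => j; apply: (key (maxn n0 j.+1) _).2; last exact: leq_maxr.
move=> [ik xz]; apply: nn0; split=> // l ln.
by apply: xz; rewrite (leq_trans ln)// leq_maxl.
Qed.

(** * Cones over graphs, relabelling, and enumeration of the group *)

Section cone.
Implicit Types a b : graph_code.

Lemma edge_sym a : symmetric (edge a).
Proof. by have [h _] := set_valP a; exact: h. Qed.

Lemma edge_irr a : irreflexive (edge a).
Proof. by have [_ h] := set_valP a; exact: h. Qed.

(** The apex is vertex 0. The cone makes every graph connected of diameter at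
    most 2, which is what forces the vertices over one point to stay
    together. *)
Definition cone a : rel nat := fun i j =>
  match i, j with
  | 0, 0 => false
  | 0, _.+1 | _.+1, 0 => true
  | i.+1, j.+1 => edge a i j
  end.

Lemma cone_sym a : symmetric (cone a).
Proof. by move=> [|i] [|j] //=; exact: edge_sym. Qed.

Lemma cone_irr a : irreflexive (cone a).
Proof. by move=> [|i] //=; exact: edge_irr. Qed.

Lemma cone_apex a i : cone a 0 i = (i != 0%N).
Proof. by case: i. Qed.

(** An isomorphism of cones need not preserve the apex, but it maps the apex to
    a vertex adjacent to all others. Exchanging such a vertex with the apex is
    an automorphism of the cone, so the apex may be assumed to be preserved. *)
Lemma cone_descend a b (phi psi : nat -> nat) : cancel phi psi -> cancel psi phi ->
  (forall i j, cone a i j = cone b (phi i) (phi j)) -> graph_iso a b.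
Proof.
wlog phi0 : phi psi / phi 0%N = 0%N.
  move=> wl phiK psiK ab; pose t := psi 0%N.
  pose s i := if i == 0%N then t else if i == t then 0%N else i.
  have sK : involutive s.
    move=> i; rewrite /s; case: (i =P 0%N) => [->|i0].
      by rewrite eqxx; case: eqP => // ->.
    by case: (i =P t) => [->|it]; rewrite ?eqxx//; do 2!case: eqP => //.
  have univ i : cone a t i = (i != t).
    by rewrite ab psiK cone_apex -[in RHS](phiK i) (can_eq psiK).
  have univ' i : cone a i t = (i != t) by rewrite cone_sym univ.
  have sE i j : cone a (s i) (s j) = cone a i j.
    have apex' k : cone a k 0 = (k != 0%N) by rewrite cone_sym cone_apex.
    rewrite /s; have [->|i0] := eqVneq i 0%N; have [->|j0] := eqVneq j 0%N => //.
    - by rewrite !cone_irr.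
    - have [->|jt] := eqVneq j t; first by rewrite cone_sym.
      by rewrite univ cone_apex jt j0.
    - have [->|it] := eqVneq i t; first by rewrite cone_sym.
      by rewrite univ' apex' it i0.
    have [it|it] := eqVneq i t; have [jt|jt] := eqVneq j t => //.
    - by rewrite it jt !cone_irr.
    - by rewrite it cone_apex univ j0 jt.
    by rewrite jt apex' univ' i0 it.
  apply: (wl (phi \o s) (s \o psi)).
  - by rewrite /= /s eqxx psiK.
  - by move=> i; rewrite /= phiK sK.
  - by move=> i; rewrite /= sK psiK.
  - by move=> i j; rewrite /= -ab sE.
move=> phiK psiK ab.
have psi0 : psi 0%N = 0%N by rewrite -phi0 phiK.
have phiS i : phi i.+1 = (phi i.+1).-1.+1.
  by case E: (phi i.+1) => //; have := phiK i.+1; rewrite E psi0.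
have psiS i : psi i.+1 = (psi i.+1).-1.+1.
  by case E: (psi i.+1) => //; have := psiK i.+1; rewrite E phi0.
exists (fun i => (phi i.+1).-1).
  exists (fun i => (psi i.+1).-1) => i; first by rewrite -phiS phiK.
  by rewrite -psiS psiK.
by move=> i j; have := ab i.+1 j.+1; rewrite phiS (phiS j).
Qed.

(** Every vertex is adjacent to the apex, so all sites over [y] come from sites
    over the point of the site that gives the apex. *)
Lemma cone_column a b F G y : giso (cone a) (cone b) F G ->
  exists x, forall j, exists i, corresponds (cone a) F x i y j.
Proof.
move=> FG; have [x [i xi]] := corresponds_exists y 0 FG.
exists x => -[|j]; first by exists i.
have [z [k zk]] := corresponds_exists y j.+1 FG; exists k.
by have [<- _] := corresponds_adjacent (@cone_sym a) (@cone_sym b) (@cone_irr b) FG zk xi isT.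
Qed.

(** The base point [y] is arbitrary. The column over [y] comes from the one over
    some [x], and the latter from the one over some [z]; the two share a site,
    so that [z = y] and the two columns correspond. *)
Lemma giso_graph_iso a b F G : giso (cone a) (cone b) F G -> graph_iso a b.
Proof.
move=> FG; have GF := giso_sym FG; pose y : cantor := fun=> false.
have [x xy] := cone_column y FG; have [z zx] := cone_column x GF.
have yz : y = z.
  have [i xi] := xy 0%N; have [j zj] := zx i.
  by have [] := corresponds_inj (corresponds_sym FG xi) zj.
rewrite -{}yz {z} in zx.
have [psi psiP] := choice xy; have [phi phiP] := choice zx.
apply: (@cone_descend a b phi psi).
- by move=> i; have [] := corresponds_inj (psiP (phi i)) (corresponds_sym GF (phiP i)).
- by move=> i; have [] := corresponds_inj (phiP (psi i)) (corresponds_sym FG (psiP i)).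
move=> i j; apply/idP/idP => ij.
  by have [] := corresponds_adjacent (@cone_sym b) (@cone_sym a) (@cone_irr a) GF
    (phiP i) (phiP j) ij.
by have [] := corresponds_adjacent (@cone_sym a) (@cone_sym b) (@cone_irr b) FG
    (corresponds_sym GF (phiP i)) (corresponds_sym GF (phiP j)) ij.
Qed.

(** A permutation of the vertices enters through its inverse [psi], so that
    relabelling is composition with [psi]. *)
Definition frelabel (psi : nat -> nat) (u : fiber) := Fiber
  (fun i => bpart u (psi i)) (fun i => apart u (psi i))
  (fun i j => cpart u (psi i) (psi j)).

Lemma frelabelK phi psi : cancel psi phi -> cancel (frelabel phi) (frelabel psi).
Proof. by move=> psiK u; apply: fiber_ext => [i|i|i j] /=; rewrite ?psiK. Qed.

Definition relabel psi (g : cantor -> fiber) : cantor -> fiber :=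
  fun x => frelabel psi (g x).

Lemma relabelK phi psi : cancel psi phi -> cancel (relabel phi) (relabel psi).
Proof. by move=> psiK g; apply/funext => x; exact: frelabelK. Qed.

Lemma carrier_relabel phi psi g : cancel psi phi ->
  carrier g -> carrier (relabel psi g).
Proof.
move=> psiK [n [gn gs]]; exists (maxn n (\max_(i < n) phi i).+1).
split=> [x y xy|x i]; last rewrite geq_max => /andP[_ mi].
  by rewrite /relabel (gn x y)// => i ni; apply: xy; rewrite leq_max ni.
have ni : (n <= psi i)%N.
  rewrite leqNgt; apply: contraTN mi => pin; rewrite -ltnNge ltnS.
  by rewrite -{1}(psiK i) (leq_bigmax (Ordinal pin)).
have [b0 a0 c0] := gs x _ ni; split=> // j; exact: c0.
Qed.

Lemma giso_relabel a b (phi psi : nat -> nat) : cancel phi psi -> cancel psi phi ->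
  (forall i j, cone a i j = cone b (phi i) (phi j)) ->
  giso (cone a) (cone b) (relabel psi) (relabel phi).
Proof.
move=> phiK psiK ab; split=> [g cg|g cg|g h cg ch].
- by split; [exact: (carrier_relabel psiK cg)|rewrite relabelK].
- by split; [exact: (carrier_relabel phiK cg)|rewrite relabelK].
apply/funext => x; apply: fiber_ext => // i j /=.
by rewrite /relabel /gmul /chi /= ab !psiK.
Qed.

Lemma graph_iso_cone a b : graph_iso a b -> exists phi psi,
  [/\ cancel phi psi, cancel psi phi &
      forall i j, cone a i j = cone b (phi i) (phi j)].
Proof.
move=> [phi [psi phiK psiK] ab].
exists (fun i => if i is j.+1 then (phi j).+1 else 0%N).
exists (fun i => if i is j.+1 then (psi j).+1 else 0%N).
by split=> [[|i]|[|i]|[|i] [|j]] //=; rewrite ?phiK ?psiK.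
Qed.

Lemma differ_relabel psi phi g h : cancel phi psi ->
  differ (relabel psi g) (relabel psi h) = differ g h.
Proof.
move=> phiK; apply/funext => x; apply/asbool_equiv_eq; split; apply: contra_not.
  by rewrite /relabel => ->.
exact: (can_inj (frelabelK phiK)).
Qed.

End cone.

Section tree_surjection.
Variables (P : finType) (U : Type) (iota : P -> U).

Lemma leaf_depends n (t : tree P n) : depends n (leaf iota t).
Proof.
elim: n t => [//|n IH] t x y xy /=; rewrite xy//.
by apply: IH => i ni; exact: xy.
Qed.

Lemma leaf_range n (t : tree P n) x : exists p, leaf iota t x = iota p.
Proof. by elim: n t x => [t x|n IH t x] /=; [exists t|]. Qed.

Lemma leaf_inj n : injective iota -> injective (@leaf P U iota n).
Proof.
move=> iI; elim: n => [|n IH] /= s t st; first exact/iI/(congr1 (@^~ (fun=> false)) st).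
case: s t st => [s1 s2] [t1 t2] st; congr pair; apply/IH/funext => x.
  exact: (congr1 (@^~ (scons false x)) st).
exact: (congr1 (@^~ (scons true x)) st).
Qed.

Lemma leaf_surj n (g : cantor -> U) : depends n g ->
  (forall x, exists p, g x = iota p) -> exists t : tree P n, leaf iota t = g.
Proof.
elim: n g => [|n IH] g gn gP.
  have [p gp] := gP (fun=> false); exists p; apply/funext => x /=.
  by rewrite -gp; exact: gn.
have [s1 s1E] := IH _ (depends_scons false gn) (fun x => gP _).
have [s2 s2E] := IH _ (depends_scons true gn) (fun x => gP _).
exists (s1, s2); apply/funext => x /=.
have -> : g x = g (scons (x 0%N) (fun i => x i.+1)) by apply: gn => -[].
by case: (x 0%N); rewrite ?s1E ?s2E.
Qed.

End tree_surjection.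

Section finite_fibers.
Variable n : nat.

Definition ffiber : finType :=
  ({ffun 'I_n -> bool} * {ffun 'I_n -> 'F_3} * {ffun 'I_n * 'I_n -> 'F_5})%type.

Definition extend A (d : A) (f : 'I_n -> A) (i : nat) := oapp f d (insub i).

(** Extension by zero of data indexed by ['I_n]: the finite group [H_n]. *)
Definition fiber_of (p : ffiber) : fiber := Fiber
  (extend false p.1.1) (extend 0 p.1.2)
  (fun i j => extend 0 (fun k => extend 0 (fun l => p.2 (k, l)) j) i).

Lemma extend_ord A (d : A) f (i : 'I_n) : extend d f i = f i.
Proof. by rewrite /extend valK. Qed.

Lemma extend_out A (d : A) f i : (n <= i)%N -> extend d f i = d.
Proof. by move=> ni; rewrite /extend insubN// -leqNgt. Qed.

Lemma fiber_of_inj : injective fiber_of.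
Proof.
move=> [[b a] c] [[b' a'] c'] E; congr (_, _, _); apply/ffunP.
- by move=> i; have := congr1 (fun u => bpart u i) E; rewrite /= !extend_ord.
- by move=> i; have := congr1 (fun u => apart u i) E; rewrite /= !extend_ord.
- by move=> [i j]; have := congr1 (fun u => cpart u i j) E; rewrite /= !extend_ord.
Qed.

Lemma supported_fiber_of u : supported n u <-> exists p, u = fiber_of p.
Proof.
split=> [us|[p ->] i ni]; last first.
  split; rewrite /= ?extend_out// => j; split; first by rewrite extend_out.
  have [nj|jn] := leqP n j; first by rewrite extend_out.
  by rewrite (extend_ord _ _ (Ordinal jn)) extend_out.
exists ([ffun i : 'I_n => bpart u i], [ffun i : 'I_n => apart u i],
  [ffun ij : 'I_n * 'I_n => cpart u ij.1 ij.2]).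
have ext A (d : A) f (h : nat -> A) i : (forall i : 'I_n, f i = h i) ->
    ((n <= i)%N -> h i = d) -> h i = extend d f i.
  move=> fh hd; have [ni|ni] := leqP n i; first by rewrite extend_out ?hd.
  by rewrite (extend_ord _ _ (Ordinal ni)) fh.
apply: fiber_ext => [i|i|i j] /=.
- by apply: ext => [k|ni]; [rewrite ffunE|have [] := us i ni].
- by apply: ext => [k|ni]; [rewrite ffunE|have [] := us i ni].
- apply: (ext _ _ _ (fun i => cpart u i j)) => [k|ni]; last first.
    by have [_ _ /(_ j)[]] := us i ni.
  apply/esym/ext => [l|nj]; first by rewrite ffunE.
  by have [_ _ /(_ k)[]] := us j nj.
Qed.

Definition ftree : finType := tree ffiber n.

Definition ftree_fun : ftree -> cantor -> fiber := @leaf ffiber fiber fiber_of n.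

Lemma ftree_fun_inj : injective ftree_fun.
Proof. exact/leaf_inj/fiber_of_inj. Qed.

Lemma bounded_range : bounded n = range ftree_fun.
Proof.
apply/seteqP; split=> [g [gn gs]|_ [t _ <-]].
  have [t <-] := leaf_surj gn (fun x => (supported_fiber_of _).1 (gs x)).
  by exists t.
split; first exact: leaf_depends.
by move=> x; apply/supported_fiber_of; exact: leaf_range.
Qed.

End finite_fibers.

(** The carrier is infinite and is the union of the finite sets [bounded n].
    One enumeration is fixed for all graphs, which makes the metric independent
    of the graph and the multiplication table depend on it locally. *)
Lemma carrier_enumeration : exists (dec : nat -> cantor -> fiber)
    (enc : (cantor -> fiber) -> nat),
  (forall n, carrier (dec n)) /\ cancel dec enc /\
  forall g, carrier g -> dec (enc g) = g.
Proof.
have cnt : countable carrier.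
  have -> : carrier = range (fun s : {n & ftree n} => ftree_fun (projT2 s)).
    apply/seteqP; split=> [g [n]|_ [[n t] _ <-]].
      by rewrite bounded_range => -[t _ <-]; exists (existT _ n t).
    by exists n; rewrite bounded_range; exists t.
  exact: card_le_trans (card_image_le _ _) (countableP _).
have inf : infinite_set carrier.
  pose f n := ind2 (fun _ i => i == n).
  have f_inj : injective f.
    move=> m n /(congr1 (@^~ (fun=> false)))/(congr1 (fun u => bpart u m)) /=.
    by rewrite eqxx => /esym/eqP.
  move=> /(finite_preimage (in2W f_inj)); rewrite (_ : _ @^-1` _ = setT).
    exact: infinite_nat.
  apply/seteqP; split=> // n _; apply: carrier_ind2.
  by exists n.+1; split=> // x i /eqP ->.
have /pcard_eqP[f] := eq_card_nat cnt inf.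
have fI : {in carrier &, injective f} by exact: 'inj_f.
have /choice[dec decP] : forall n, exists g, carrier g /\ f g = n.
  by move=> n; have [g cg <-] := 'surj_f (I : setT n); exists g.
exists dec, f; split; first by move=> n; exact: (decP n).1.
split=> [n|g cg]; first exact: (decP n).2.
apply: fI; rewrite ?inE//; first exact: (decP _).1.
exact: (decP _).2.
Qed.

(** * The metric and the code of the group *)

Section metric.
Context {R : realType}.
Implicit Types g h : cantor -> fiber.

Definition dist g h : R := density (differ g h).

Lemma dist_bounded n g h : bounded n g -> bounded n h ->
  dist g h = avg n (differ g h).
Proof. by move=> [gn _] [hn _]; rewrite /dist (densityE (depends_differ gn hn)). Qed.

Lemma distxx g : dist g g = 0.
Proof.
rewrite /dist (_ : differ g g = fun=> false).
  by rewrite (@densityE _ 0) ?avg_false.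
by apply/funext => x; apply/asboolP; apply.
Qed.

Lemma dist_sym g h : dist g h = dist h g.
Proof.
congr density; apply/funext => x; apply/asbool_equiv_eq; split => /nesym//.
Qed.

Lemma dist_positivity g h : carrier g -> carrier h -> dist g h = 0 -> g = h.
Proof.
move=> cg ch; have [n [gn hn]] := carrier_common cg ch.
rewrite (dist_bounded gn hn) => /avg_eq0 gh; apply/funext => x.
have /gh/(_ x) : depends n (differ g h) by apply: depends_differ; [exact: gn.1|exact: hn.1].
by move/asboolP; apply: contrapT.
Qed.

(** The triangle inequality and the Lipschitz bounds for products and inverses
    are all instances. *)
Lemma dist_le2 g h g1 h1 g2 h2 : carrier g1 -> carrier h1 -> carrier g2 ->
  carrier h2 -> carrier g -> carrier h ->
  (forall x, g1 x = h1 x -> g2 x = h2 x -> g x = h x) ->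
  dist g h <= dist g1 h1 + dist g2 h2.
Proof.
move=> cg1 ch1 cg2 ch2 cg ch H.
have [n1 [gn1 hn1]] := carrier_common cg1 ch1.
have [n2 [gn2 hn2]] := carrier_common cg2 ch2.
have [n3 [gn3 hn3]] := carrier_common cg ch.
pose n := maxn (maxn n1 n2) n3.
have le1 : (n1 <= n)%N by rewrite !leq_max leqnn.
have le2 : (n2 <= n)%N by rewrite !leq_max leqnn orbT.
have le3 : (n3 <= n)%N by rewrite !leq_max leqnn orbT.
have b m k : (m <= n)%N -> bounded m k -> bounded n k := fun mn => @bounded_leq _ _ mn k.
rewrite (dist_bounded (b _ _ le1 gn1) (b _ _ le1 hn1)).
rewrite (dist_bounded (b _ _ le2 gn2) (b _ _ le2 hn2)).
rewrite (dist_bounded (b _ _ le3 gn3) (b _ _ le3 hn3)).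
apply: avg_subadditive => x /asboolP gh; apply/orP.
have [e1|] := pselect (g1 x = h1 x); [right|left]; apply/asboolP => //.
by move=> e2; exact/gh/H.
Qed.

Lemma dist_triangle g h k : carrier g -> carrier h -> carrier k ->
  dist g k <= dist g h + dist h k.
Proof. by move=> cg ch ck; apply: dist_le2 => // x -> ->. Qed.

(** Invariance of the metric under translations on both sides follows from
    this inequality and from [distxx]. *)
Lemma distM r g h g' h' : carrier g -> carrier h -> carrier g' -> carrier h' ->
  dist (gmul r g h) (gmul r g' h') <= dist g g' + dist h h'.
Proof.
move=> *; apply: dist_le2 => //; [exact: carrierM|exact: carrierM|].
by rewrite /gmul => x -> ->.
Qed.

Lemma distV r g h : carrier g -> carrier h ->
  dist (ginv r g) (ginv r h) <= dist g h.
Proof.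
move=> cg ch; rewrite -[leRHS]addr0 -(distxx g).
apply: dist_le2 => //; [exact: carrierV|exact: carrierV|].
by rewrite /ginv => x ->.
Qed.

End metric.

Section metric_nat_topology.
Context (R : realType) (d : nat * nat -> R) (hd : is_metric d).

Lemma metric_nat_nbhsP (x : metric_nat hd) (A : set (metric_nat hd)) :
  nbhs x A <-> exists2 e : R, 0 < e & forall y, d (x, y) < e -> A y.
Proof. by split=> [/nbhs_ballP|H]; [|apply/nbhs_ballP]. Qed.

End metric_nat_topology.

Section coding.
Context (R : realType).
Variables (dec : nat -> cantor -> fiber) (enc : (cantor -> fiber) -> nat).
Hypotheses (decC : forall n, carrier (dec n)) (decK : cancel dec enc)
  (encK : forall g, carrier g -> dec (enc g) = g).

Definition dist_num (p : nat * nat) : R := dist (dec p.1) (dec p.2).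

Lemma dist_num_metric : is_metric dist_num.
Proof.
split=> [x|x y|x y|y x z]; rewrite /dist_num /=.
- exact: distxx.
- by move=> /(dist_positivity (decC x) (decC y)) /(can_inj decK).
- exact: dist_sym.
- exact: dist_triangle.
Qed.

Definition mul_num r x y := enc (gmul r (dec x) (dec y)).
Definition one_num := enc gone.
Definition inv_num r x := enc (ginv r (dec x)).

Lemma dec_mul_num r x y : dec (mul_num r x y) = gmul r (dec x) (dec y).
Proof. by rewrite encK//; exact: carrierM. Qed.
Lemma dec_one_num : dec one_num = gone.
Proof. by rewrite encK//; exact: carrier1. Qed.
Lemma dec_inv_num r x : dec (inv_num r x) = ginv r (dec x).
Proof. by rewrite encK//; exact: carrierV. Qed.

Definition code_of_rel r : group_code_space R := (fun p => mul_num r p.1.1 p.1.2 == p.2, dist_num).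

Lemma code_of_rel_codes r : @group_codes R (code_of_rel r).
Proof.
constructor; apply: (@CodedGroup _ (code_of_rel r) dist_num_metric (mul_num r) one_num (inv_num r)).
- by move=> x y z; apply: (can_inj decK); rewrite !dec_mul_num gmulA.
- by move=> x; apply: (can_inj decK); rewrite !dec_mul_num dec_one_num gmul1.
- by move=> x; apply: (can_inj decK); rewrite !dec_mul_num dec_one_num gmulr1.
- by move=> x; apply: (can_inj decK); rewrite !dec_mul_num dec_one_num dec_inv_num gmulV.
- by move=> x; apply: (can_inj decK); rewrite !dec_mul_num dec_one_num dec_inv_num gmulrV.
- by [].
- move=> -[x y] A /= /metric_nat_nbhsP[e e0 eA].
  exists ([set u | dist_num (x, u) < e / 2], [set v | dist_num (y, v) < e / 2]).
    by split; apply/metric_nat_nbhsP; exists (e / 2) => //; rewrite divr_gt0.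
  move=> [u v] [/= xu yv]; apply: eA.
  rewrite /dist_num /= !dec_mul_num (le_lt_trans (distM _ _ _ _ _))//.
  by rewrite [e]splitr ltrD.
- move=> x A /= /metric_nat_nbhsP[e e0 eA].
  apply/metric_nat_nbhsP; exists e => // y xy; apply: eA.
  by rewrite /dist_num /= !dec_inv_num (le_lt_trans (distV _ _ _)).
Qed.

Definition coded_by_rel r : group_code R := exist _ (code_of_rel r) (mem_set (code_of_rel_codes r)).

(** The group structure on the coded group is obtained by choice from the code,
    but its multiplication is determined by the code. *)
Lemma coded_by_rel_mul r (x y : code_group (coded_by_rel r)) : (x * y)%g = mul_num r x y :> nat.
Proof.
have := cg_graph (coded_group_of (coded_by_rel r)) x y (mul_num r x y).
by rewrite /= eqxx => /esym/eqP.
Qed.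

Lemma coded_by_rel_one r : (1%g : code_group (coded_by_rel r)) = one_num :> nat.
Proof.
apply: (can_inj decK); rewrite dec_one_num.
have := coded_by_rel_mul (1%g : code_group (coded_by_rel r)) 1%g; rewrite mulg1 => /(congr1 dec).
rewrite dec_mul_num => /(congr1 (gmul r (ginv r (dec (1%g : code_group (coded_by_rel r)))))).
by rewrite gmulA gmulV gmul1.
Qed.

Lemma coded_by_rel_nbhsP r (x : code_group (coded_by_rel r))
    (A : set (code_group (coded_by_rel r))) :
  nbhs x A <-> exists2 e : R, 0 < e & forall y : nat, dist_num (x, y) < e -> A y.
Proof. exact: metric_nat_nbhsP. Qed.

End coding.

(** * The Levy property *)

Section uniform_probability.
Context {R : realType} d (T : measurableType d) (I : finType) (i0 : I) (e : I -> T).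
Local Open Scope ereal_scope.

Lemma invn_ge0 n : (0 <= n%:R^-1 :> R)%R.
Proof. by rewrite invr_ge0 ler0n. Qed.

(** The indices are enumerated as a sequence of natural numbers with default
    [i0]; only the first [#|I|] of them count. *)
Definition uniform_on : set T -> \bar R :=
  mscale (NngNum (invn_ge0 #|I|)) (msum (fun k => \d_(e (nth i0 (enum I) k))) #|I|).

HB.instance Definition _ := Measure.on uniform_on.

Lemma uniform_onE (A : set T) :
  uniform_on A = ((\sum_(i : I) (e i \in A)%:R) / #|I|%:R)%:E.
Proof.
rewrite /uniform_on /mscale /= /msum.
rewrite (eq_bigr (fun k : 'I_#|I| => (e (nth i0 (enum I) k) \in A)%:R%:E)); last first.
  by move=> k _; exact: diracE.
rewrite sumEFin -EFinM mulrC; congr (_ / _)%:E.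
rewrite -[RHS]big_enum /= (big_nth i0) big_mkord -cardE.
by apply: eq_bigr => i _.
Qed.

Lemma uniform_on_setT : uniform_on setT = 1.
Proof.
rewrite uniform_onE (eq_bigr (fun=> 1%R)); last by move=> i _; rewrite in_setT.
rewrite sumr_const divff// pnatr_eq0 -lt0n; apply/card_gt0P; by exists i0.
Qed.

HB.instance Definition _ := Measure_isProbability.Build _ _ _ uniform_on uniform_on_setT.

End uniform_probability.

Section bounded_below.
Context {R : realType}.
Local Open Scope ereal_scope.

(** The lower limit is the supremum of the infima of the tails, so a positive
    lower limit means that some tail is bounded below by a positive
    number. *)
Lemma limn_einf_gt0 (u : (\bar R)^nat) : 0 < limn_einf u ->
  exists2 c : R, (0 < c)%R & \forall n \near \oo, c%:E <= u n.
Proof.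
rewrite limn_einf_lim (cvg_lim _ (@cvg_einfs_sup _ u))//.
move=> /ereal_sup_gt[_ [n _ <-]] un.
have [c c0 cun] : exists2 c : R, (0 < c)%R & c%:E <= einfs u n.
  move: un; case: (einfs u n) => [r r0|_|//]; first by exists r.
  by exists 1%R => //; rewrite leey.
exists c => //; exists n => // k /= nk; apply: le_trans cun _.
by apply: ereal_inf_lbound; exists k.
Qed.

End bounded_below.

Section levy.
Context (R : realType).
Variables (dec : nat -> cantor -> fiber) (enc : (cantor -> fiber) -> nat).
Hypotheses (decC : forall n, carrier (dec n)) (decK : cancel dec enc)
  (encK : forall g, carrier g -> dec (enc g) = g).
Variable r : rel nat.

Local Notation G := (code_group (coded_by_rel R decC decK encK r)).

Let D (x : G) : cantor -> fiber := dec x.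

Let DM (x y : G) : D (x * y)%g = gmul r (D x) (D y).
Proof. by rewrite /D coded_by_rel_mul dec_mul_num. Qed.
Let D1 : D 1%g = gone.
Proof. by rewrite /D coded_by_rel_one dec_one_num. Qed.
Let DV (x : G) : D (x^-1)%g = ginv r (D x).
Proof.
have : gmul r (D (x^-1)%g) (D x) = gone by rewrite -DM mulVg D1.
by move=> /(congr1 (fun g => gmul r g (ginv r (D x)))); rewrite -gmulA gmulrV gmulr1 gmul1.
Qed.

Lemma tree_carrier n (t : ftree n) : carrier (ftree_fun t).
Proof. by exists n; rewrite bounded_range; exists t. Qed.

Let pt n (t : ftree n) : G := enc (ftree_fun t).

Let Dpt n (t : ftree n) : D (pt t) = ftree_fun t.
Proof. by rewrite /D /pt encK//; exact: tree_carrier. Qed.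

Let pt_inj n : injective (@pt n).
Proof. by move=> s t /(congr1 D); rewrite !Dpt => /ftree_fun_inj. Qed.

Let K n : set G := [set x | bounded n (D x)].

Let KE n : K n = range (@pt n).
Proof.
apply/seteqP; split=> [x|_ [t _ <-]].
  rewrite /K /= bounded_range => -[t _ tx]; exists t => //.
  by apply: (can_inj decK); rewrite -/(D _) Dpt.
by rewrite /K /= Dpt bounded_range; exists t.
Qed.

Let K1 n : K n 1%g. Proof. by rewrite /K /= D1; exact: bounded1. Qed.
Let KM n x y : K n x -> K n y -> K n (x * y)%g.
Proof. by rewrite /K /= DM; exact: boundedM. Qed.
Let KV n x : K n x -> K n (x^-1)%g.
Proof. by rewrite /K /= DV; exact: boundedV. Qed.

Let Kfin n (A : set G) : A `<=` K n -> finite_set A.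
Proof. by move=> /sub_finite_set; apply; rewrite KE; exact: finite_image. Qed.

Let tree0 n : {t : ftree n | pt t = 1%g}.
Proof. by apply: cid; have := K1 n; rewrite KE => -[t _ t1]; exists t. Qed.

Let mu n : probability (borel G) R := uniform_on (sval (tree0 n)) (@pt n : _ -> borel G).

Let N n : R := #|ftree n|%:R.

Let muE n (A : set G) : mu n A = ((\sum_(t : ftree n) (pt t \in A)%:R) / N n)%:E.
Proof. exact: uniform_onE. Qed.

Let N_gt0 n : 0 < N n.
Proof. by rewrite ltr0n; apply/card_gt0P; exists (sval (tree0 n)). Qed.

Let mu_eq n (A B : set G) : (forall t : ftree n, A (pt t) <-> B (pt t)) ->
  mu n A = mu n B.
Proof.
move=> AB; rewrite !muE; congr (_ / _)%:E; apply: eq_bigr => t _.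
by congr (nat_of_bool _)%:R; apply/idP/idP; rewrite !inE => /AB.
Qed.

(** Left translation by an element of [K n] permutes [K n], and every subset of
    [K n] is finite, hence compact. *)
Let K_haar n : normalized_haar (K n) (mu n).
Proof.
have muK : mu n (K n) = 1%E.
  rewrite -(probability_setT (mu n)); apply: mu_eq => t; split=> // _.
  by rewrite KE; exists t.
split=> // [x A Kx _|A _].
  have /choice[s sE] : forall t : ftree n, exists s : ftree n, pt s = (x * pt t)%g.
    move=> t; have : K n (x * pt t)%g by apply: KM => //; rewrite KE; exists t.
    by rewrite KE => -[s _ <-]; exists s.
  have s_inj : injective s.
    by move=> t u /(congr1 (@pt n)); rewrite !sE => /mulgI /pt_inj.
  rewrite !muE (reindex_inj s_inj); congr (_ / _)%:E; apply: eq_bigr => t _.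
  rewrite sE; congr (nat_of_bool _)%:R; apply/idP/idP; rewrite !inE /=.
    by move=> [a Aa /mulgI <-].
  by move=> At; exists (pt t).
apply/le_anti/andP; split.
  rewrite (@mu_eq n A (A `&` K n)).
    apply: ereal_sup_ubound; exists (A `&` K n) => //.
    have fin : finite_set (A `&` K n) by apply: Kfin; exact: subIsetr.
    have cA := finite_compact fin; split=> //.
    apply: compact_closed (@metric_hausdorff R G) cA.
  by move=> t; split=> [At|[]//]; split=> //; rewrite KE; exists t.
apply: ge_ereal_sup => _ [C [_ _ CA] <-].
rewrite !muE lee_fin ler_pM2r ?invr_gt0//; apply: ler_sum => t _.
rewrite ler_nat; case: (boolP (pt t \in C)) => //; rewrite inE => /CA At.
by rewrite mem_set.
Qed.

(** By invariance of the metric, a point of [K n] outside [V A] is at distance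
    at least [e] from [A]. *)
Let blow_up (n : nat) (A V : set G) (e c : R) : 0 < e -> 0 < c ->
  (forall v : G, @dist R (D v) gone < e -> V v) -> (c%:E <= mu n A)%E ->
  exists2 m : R, mu n [set (v * a)%g | v in V & a in A] = m%:E &
    1 - m <= (c * e ^+ 2)^-1 / 2 ^+ n /\ m <= 1.
Proof.
move=> e0 c0 Ve cA; set B := [set _ | _ in _ & _ in _].
pose PA := [pred t : ftree n | pt t \in A].
pose PB := [pred t : ftree n | pt t \notin B].
have sep s t : s \in PA -> t \in PB -> e <= tree_dist (fiber_of (n:=n)) s t.
  rewrite !inE => As; rewrite leNgt; apply: contraNN => st; rewrite inE.
  (* [t = (t s^-1) s], and [t s^-1] is as close to 1 as [t] is to [s]. *)
  exists (pt t * (pt s)^-1)%g; last by exists (pt s) => //; rewrite mulgVK.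
  apply: Ve; rewrite DM DV !Dpt -(gmulrV r (ftree_fun s)).
  have cs := tree_carrier s; have ct := tree_carrier t.
  apply: le_lt_trans (distM _ ct (carrierV r cs) cs (carrierV r cs)) _.
  rewrite distxx addr0 dist_sym (@dist_bounded _ n)// bounded_range.
    by exists s.
  by exists t.
have := tree_concentration e0 sep; rewrite -/(N n) => conc.
have PAE : \sum_(t : ftree n) (pt t \in A)%:R = #|PA|%:R :> R.
  by rewrite -natr_sum -sum1_card [in RHS]big_mkcond.
have PBE : \sum_(t : ftree n) (pt t \in B)%:R = N n - #|PB|%:R :> R.
  rewrite /N -(cardC PB) natrD addrAC subrr add0r -natr_sum -sum1_card [in RHS]big_mkcond.
  by congr (_%:R); apply: eq_bigr => t _; rewrite !inE negbK; case: (_ \in _).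
exists ((N n - #|PB|%:R) / N n); first by rewrite muE PBE.
have Nn := N_gt0 n; have c_le : c * N n <= #|PA|%:R.
  by move: cA; rewrite muE PAE lee_fin ler_pdivlMr.
split; last by rewrite ler_pdivrMr// mul1r lerBlDr lerDl ler0n.
have -> : 1 - (N n - #|PB|%:R) / N n = #|PB|%:R / N n by field; exact: lt0r_neq0.
have p2 : 0 < (2 : R) ^+ n by rewrite exprn_gt0.
rewrite ler_pdivrMr// -(ler_pM2l (mulr_gt0 c0 (exprn_gt0 2 e0))).
rewrite -(ler_pM2r Nn).
have -> : c * e ^+ 2 * ((c * e ^+ 2)^-1 / 2 ^+ n * N n) * N n = N n ^+ 2 / 2 ^+ n.
  by field; rewrite !lt0r_neq0.
apply: le_trans conc; rewrite [leLHS](_ : _ = e ^+ 2 * (c * N n) * #|PB|%:R); last by ring.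
by rewrite ler_wpM2r// ler_wpM2l// sqr_ge0.
Qed.

(** The witnesses are the finite subgroups [K n] with their uniform measures.
    By [blow_up] the measure of the complement of [V A_n] is at most a
    constant times [2^-n]. *)
Lemma coded_by_rel_levy : levy_property R G.
Proof.
exists K, mu; split.
- move=> n; split; first by apply: finite_compact; exact: (@Kfin n).
  split; first by rewrite inE; exact: K1.
  by move=> x y; rewrite !inE => Kx Ky; apply: KM => //; exact: KV.
- by move=> m n mn x; exact: bounded_leq.
- exact: K_haar.
- move=> O [x Ox] _; exists x; split=> //.
  by have [n xn] := decC x; exists n.
move=> V A Vo V1 AK /limn_einf_gt0[c c0 cA].
have [e e0 Ve] : exists2 e : R, 0 < e & forall v : G, @dist R (D v) gone < e -> V v.
  have /coded_by_rel_nbhsP[e e0 Ve] := open_nbhs_nbhs (conj Vo V1).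
  by exists e => // v ve; apply: Ve; rewrite /dist_num /= -/(D _) D1 dist_sym.
apply/fine_cvgP; split.
  by apply: nearW => n; rewrite muE.
apply/cvgrPdist_le => /= d d0.
have : geometric ((c * e ^+ 2)^-1) (2^-1 : R) @ \oo --> (0:R).
  by apply: cvg_geometric; rewrite ger0_norm ?invr_ge0// invf_lt1// ltr1n.
move=> /cvgrPdist_le/(_ d d0) geo; near=> n.
have cAn : (c%:E <= mu n (A n))%E by near: n.
have [m -> [m1 m2]] := blow_up e0 c0 Ve cAn.
rewrite /= ger0_norm ?subr_ge0//; apply: le_trans m1 _.
have : `|0 - geometric ((c * e ^+ 2)^-1) (2^-1 : R) n| <= d by near: n.
rewrite /geometric /= sub0r normrN exprVn; apply: le_trans; exact: ler_norm.
Unshelve. all: by end_near. Qed.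

End levy.

(** * The Borel reduction *)

(** The sets with Borel preimage form a sigma-algebra that contains the open
    sets. *)
Lemma continuous_borel_fun (X Y : topologicalType) (f : X -> Y) :
  continuous f -> borel_fun f.
Proof.
move=> /continuousP cf B; apply: (@smallest_sub _ _ _ [set A | <<s (@open X) >> (f @^-1` A)]).
  split=> /=; first by rewrite preimage_set0; exact: sigma_algebra0.
    move=> A mA; rewrite setTD preimage_setC -setTD.
    exact: sigma_algebraCD.
  by move=> F mF; rewrite preimage_bigcup; exact: sigma_algebra_bigcup.
by move=> A oA; apply: sub_sigma_algebra; exact: cf.
Qed.

Lemma edge_near (a : graph_code) (i j : nat) :
  \forall b \near a, edge b i j = edge a i j.
Proof.
have c : continuous (fun b : graph_code => edge b i j).
  have c1 : continuous (set_val : graph_code -> {ptws (nat * nat) -> bool}).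
    exact: initial_continuous.
  have c2 := @proj_continuous _ (fun _ : nat * nat => bool) (i, j).
  move=> b; exact: (continuous_comp (c1 b) (c2 (set_val b))).
apply: (c a [set e | e = edge a i j]).
exact: discrete_set1.
Qed.

Lemma edges_near (a : graph_code) n :
  \forall b \near a, forall i j, (i < n)%N -> (j < n)%N -> edge b i j = edge a i j.
Proof.
have : \forall b \near a, forall ij : 'I_n * 'I_n, edge b ij.1 ij.2 = edge a ij.1 ij.2.
  by apply: (@filter_forall _ _ _ (nbhs a) _) => ij; exact: edge_near.
apply: filterS => b ab i j ni nj.
exact: (ab (Ordinal ni, Ordinal nj)).
Qed.

(** An edge enters a product only through a sign in front of the component of
    the right factor at that pair, which vanishes outside the first [n]
    vertices. *)
Lemma gmul_local (r r' : rel nat) n g h : bounded n h ->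
  (forall i j, (i < n)%N -> (j < n)%N -> r i j = r' i j) ->
  gmul r g h = gmul r' g h.
Proof.
move=> [_ hs] rr'; apply/funext => x; apply: fiber_ext => // i j /=.
congr (_ + _); have [ni|ni] := leqP n i.
  by have [_ _ /(_ j)[-> _]] := hs x i ni; rewrite /sgn oppr0 !if_same.
have [nj|nj] := leqP n j.
  by have [_ _ /(_ i)[_ ->]] := hs x j nj; rewrite /sgn oppr0 !if_same.
by rewrite /chi rr'.
Qed.

Section reduction.
Context (R : realType).
Variables (dec : nat -> cantor -> fiber) (enc : (cantor -> fiber) -> nat).
Hypotheses (decC : forall n, carrier (dec n)) (decK : cancel dec enc)
  (encK : forall g, carrier g -> dec (enc g) = g).

Local Notation coded_by_rel := (coded_by_rel R decC decK encK).

Lemma mul_num_near (a : graph_code) x y :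
  \forall b \near a, mul_num dec enc (cone b) x y = mul_num dec enc (cone a) x y.
Proof.
have [n yn] := decC y; apply: filterS (edges_near a n) => b ba.
congr enc; apply: gmul_local yn _ => -[|i] [|j] //= ni nj.
by apply: ba; exact: ltnW.
Qed.

Lemma coded_by_rel_continuous : continuous (fun a => coded_by_rel (cone a)).
Proof.
apply: continuous_comp_initial => a.
suff c1 : (fun b => (code_of_rel R dec enc (cone b)).1) @ a -->
    ((code_of_rel R dec enc (cone a)).1 : {ptws (nat * nat * nat) -> bool}).
  move=> A [[B C] [/= /c1 Ba Ca] BCA]; apply: (@filterS _ (nbhs a) _ _ _ _ Ba) => b Bb.
  by apply: BCA; split=> //=; have := nbhs_singleton Ca.
have Ff : Filter ((fun b => (code_of_rel R dec enc (cone b)).1) @ nbhs a).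
  exact: fmap_filter.
apply/(@pointwise_cvgP _ _ _ _ Ff) => -[[x y] z] /=.
move=> A /nbhs_singleton Aa.
apply: (@filterS _ (nbhs a) _ _ _ _ (mul_num_near a x y)) => b /= ->; exact: Aa.
Qed.

Lemma topgroup_iso_giso a b :
  topgroup_iso (code_group (coded_by_rel (cone a))) (code_group (coded_by_rel (cone b))) ->
  exists F G, giso (cone a) (cone b) F G.
Proof.
move=> [phi [psi [phiK psiK phiM _ _]]].
exists (fun g => dec (phi (enc g))), (fun g => dec (psi (enc g))).
split=> [g cg|g cg|g h cg ch].
- by split; [exact: decC|rewrite decK phiK encK].
- by split; [exact: decC|rewrite decK psiK encK].
rewrite -(dec_mul_num decC encK); congr dec.
rewrite -(@coded_by_rel_mul R _ _ decC decK encK) -phiM; congr phi.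
by rewrite coded_by_rel_mul /mul_num !encK.
Qed.

Lemma giso_topgroup_iso a b F G : giso (cone a) (cone b) F G ->
  (forall g h, differ (F g) (F h) = differ g h) ->
  (forall g h, differ (G g) (G h) = differ g h) ->
  topgroup_iso (code_group (coded_by_rel (cone a))) (code_group (coded_by_rel (cone b))).
Proof.
move=> [FK GK FM] FD GD.
exists (fun x => enc (F (dec x))), (fun x => enc (G (dec x))); split.
- by move=> x; rewrite (encK (FK _ (decC x)).1) (FK _ (decC x)).2 decK.
- by move=> x; rewrite (encK (GK _ (decC x)).1) (GK _ (decC x)).2 decK.
- move=> x y; rewrite !coded_by_rel_mul /mul_num (encK (FK _ (decC x)).1).
  by rewrite (encK (FK _ (decC y)).1) -FM// encK//; exact: carrierM.
- move=> x A /coded_by_rel_nbhsP[e e0 eA]; apply/coded_by_rel_nbhsP; exists e => // y xy; apply: eA.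
  by rewrite /dist_num /dist /= (encK (FK _ (decC x)).1) (encK (FK _ (decC y)).1) FD.
- move=> x A /coded_by_rel_nbhsP[e e0 eA]; apply/coded_by_rel_nbhsP; exists e => // y xy; apply: eA.
  by rewrite /dist_num /dist /= (encK (GK _ (decC x)).1) (encK (GK _ (decC y)).1) GD.
Qed.

End reduction.

Theorem corollary9p2 (R : realType) :
  exists f : graph_code -> group_code R,
    [/\ borel_fun f,
        forall a : graph_code, levy_property R (code_group (f a)) &
        forall a b : graph_code,
          graph_iso a b <->
          topgroup_iso (code_group (f a)) (code_group (f b))].
Proof.
have [dec [enc [decC [decK encK]]]] := carrier_enumeration.
exists (fun a => coded_by_rel R decC decK encK (cone a)); split.
- by apply: continuous_borel_fun; exact: coded_by_rel_continuous.
- by move=> a; exact: coded_by_rel_levy.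
move=> a b; split=> [/graph_iso_cone[phi [psi [phiK psiK ab]]]|].
  apply: (giso_topgroup_iso _ _ _ _ (giso_relabel phiK psiK ab)) => g h.
    exact: (differ_relabel _ _ phiK).
  exact: (differ_relabel _ _ psiK).
by move=> /topgroup_iso_giso[F [G FG]]; exact: giso_graph_iso FG.
Qed.
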